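(* Let $n\in\mathbb{N}$ and let $S=\{1,\ldots,n\}$. (i) The free uniformly complete $f$-algebra over $S$ is $PG_n^h$ together with the map $\delta\colon S\to PG_n^h$ given by $\delta(i)=\pi_i$ for $i=1,\ldots,n$. (ii) The free uniformly complete $f$-algebra with identity over $S$ is $PG_n$ together with the map $\delta\colon S\to PG_n$ given by $\delta(i)=\pi_i$ for $i=1,\ldots,n$.
   Context: Here $\mathbb{N}=\{1,2,\ldots\}$. A lattice-ordered algebra is a real vector lattice that is also an associative real algebra in which the product of positive elements is positive. An $f$-algebra is a lattice-ordered algebra in which $x\wedge y=0$ and $z\ge 0$ imply $(zx)\wedge y=(xz)\wedge y=0$. A lattice-algebra homomorphism is a linear map preserving lattice operations and products. All vector lattices are assumed Archimedean. For a vector lattice $X$ and $e\in X_+$, $I_e$ denotes the order ideal generated by $e$, with norm $\|x\|_e=\inf\{\lambda\in[0,\infty):|x|\le\lambda e\}$. An (Archimedean) vector lattice is uniformly complete if $(I_e,\|\cdot\|_e)$ is norm complete for every $e\in X_+$; an $f$-algebra is uniformly complete if its underlying vector lattice is (in particular it is Archimedean). $PG_n$ denotes the lattice-ordered algebra (with pointwise operations) of continuous functions $f\colon\mathbb{R}^n\to\mathbb{R}$ of polynomial growth, i.e. for which there exist $N\in\mathbb{N}$ and $M\in[0,\infty)$ with $|f|\le M(\mathbf{1}+|\pi_1|+\cdots+|\pi_n|)^N$. Here $\mathbf{1}$ is the constant function one on $\mathbb{R}^n$ (the identity of $PG_n$) and $\pi_i\colon\mathbb{R}^n\to\mathbb{R}$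 is the $i$-th coordinate projection. $PG_n^h$ is the set of $f\in PG_n$ for which the limit $\lim_{t\to0^+}f(tx)/t$ exists for every $x\in\mathbb{R}^n$ and is uniform on bounded subsets of $\mathbb{R}^n$; it is equipped with the pointwise operations. For a non-empty set $S$, a free uniformly complete $f$-algebra (resp. free uniformly complete $f$-algebra with identity) over $S$ is a pair $(F,\delta)$, where $F$ is a uniformly complete $f$-algebra (resp. with identity) and $\delta\colon S\to F$ is a map, such that for every uniformly complete $f$-algebra (resp. with identity) $A$ and every map $T\colon S\to A$ there exists a unique lattice-algebra homomorphism $\hat{T}\colon F\to A$ satisfying $T=\hat{T}\circ\delta$ (resp. and sending the identity to the identity). *)

(* Defs.v *)
From HB Require Import structures.
From mathcomp Require Import all_boot all_order all_algebra.
From mathcomp Require Import all_classical all_reals all_analysis.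
From mathcomp Require Import ring lra.

Set Implicit Arguments.
Unset Strict Implicit.
Unset Printing Implicit Defensive.

Import Order.TTheory GRing.Theory Num.Theory.
Import numFieldNormedType.Exports.

Local Open Scope classical_set_scope.
Local Open Scope ring_scope.

(* The join of lmodType with MathComp's latticeType cannot be declared here:
   Hierarchy Builder would require it to precede realDomainType. So the order
   is MathComp's, and meets and joins are given by their universal properties.
   *)
HB.mixin Record isVectorLattice (R : realType) V
    of GRing.Lmodule R V & Num.POrderedZmodule V := {
  vmeet : V -> V -> V;
  vjoin : V -> V -> V;
  vmeetP : forall x y z : V, (z <= vmeet x y) = (z <= x) && (z <= y);
  vjoinP : forall x y z : V, (vjoin x y <= z) = (x <= z) && (y <= z);
  vleD2r : forall x y z : V, x <= y -> x + z <= y + z;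
  vscale_ge0 : forall (a : R) (x : V), 0 <= a -> 0 <= x -> 0 <= a *: x
}.

#[short(type="vectorLatticeType")]
HB.structure Definition VectorLattice (R : realType) :=
  { V of GRing.Lmodule R V & Num.POrderedZmodule V & isVectorLattice R V }.

(* MathComp's lalgType and algType are unital; the algebras here need not be,
   so the product is a separate operation on the underlying module. *)
HB.mixin Record isLatticeAlgebra (R : realType) A of VectorLattice R A := {
  amul : A -> A -> A;
  amulA : associative amul;
  amulDl : left_distributive amul +%R;
  amulDr : right_distributive amul +%R;
  amulZl : forall (a : R) (x y : A), amul (a *: x) y = a *: amul x y;
  amulZr : forall (a : R) (x y : A), amul x (a *: y) = a *: amul x y;
  amul_ge0 : forall x y : A, 0 <= x -> 0 <= y -> 0 <= amul x y
}.

#[short(type="latticeAlgebraType")]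
HB.structure Definition LatticeAlgebra (R : realType) :=
  { A of VectorLattice R A & isLatticeAlgebra R A }.

Section vector_lattices.
Context {R : realType} {X : vectorLatticeType R}.
Implicit Types (x y e : X) (I : set X).

Definition vabs x : X := vjoin x (- x).

Definition order_ideal I : Prop :=
  [/\ I 0,
      forall (a : R) x y, I x -> I y -> I (a *: x + y)
    & forall x y, I y -> vabs x <= vabs y -> I x].

Definition principal_ideal e : set X := smallest order_ideal [set e].

Definition enorm e x : R := inf [set l : R | 0 <= l /\ vabs x <= l *: e].

End vector_lattices.

Section vector_lattice_properties.
Context {R : realType} (X : vectorLatticeType R).

Definition vl_archimedean : Prop :=
  forall x y : X, 0 <= x -> (forall k : nat, x *+ k <= y) -> x = 0.

Definition enorm_complete (e : X) : Prop :=
  forall u : nat -> X,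
    (forall k, principal_ideal e (u k)) ->
    (forall eps : R, 0 < eps -> exists N : nat, forall p q : nat,
        (N <= p)%N -> (N <= q)%N -> enorm e (u p - u q) < eps) ->
    exists2 l : X, principal_ideal e l
                 & enorm e (u k - l) @[k --> \oo] --> (0 : R).

Definition uniformly_complete : Prop :=
  vl_archimedean /\ (forall e : X, 0 <= e -> enorm_complete e).

End vector_lattice_properties.

Definition f_algebra {R : realType} (A : latticeAlgebraType R) : Prop :=
  forall x y z : A, vmeet x y = 0 -> 0 <= z ->
    vmeet (amul z x) y = 0 /\ vmeet (amul x z) y = 0.

Definition is_identity {R : realType} {A : latticeAlgebraType R} (u : A) : Prop :=
  forall x : A, amul u x = x /\ amul x u = x.

Definition lattice_algebra_hom {R : realType} {A B : latticeAlgebraType R}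
    (f : A -> B) : Prop :=
  [/\ linear f,
      {morph f : x y / vmeet x y},
      {morph f : x y / vjoin x y}
    & {morph f : x y / amul x y}].

Definition free_uc_falgebra {R : realType} {S : Type}
    (F : latticeAlgebraType R) (delta : S -> F) : Prop :=
  [/\ f_algebra F,
      uniformly_complete F
    & forall A : latticeAlgebraType R, f_algebra A -> uniformly_complete A ->
      forall T : S -> A,
        exists! That : F -> A, lattice_algebra_hom That /\ T = That \o delta].

Definition free_uc_falgebra_with_id {R : realType} {S : Type}
    (F : latticeAlgebraType R) (oneF : F) (delta : S -> F) : Prop :=
  [/\ f_algebra F,
      uniformly_complete F,
      is_identity oneF
    & forall (A : latticeAlgebraType R) (oneA : A),
      f_algebra A -> uniformly_complete A -> is_identity oneA ->
      forall T : S -> A,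
        exists! That : F -> A,
          [/\ lattice_algebra_hom That, That oneF = oneA & T = That \o delta]].

Section PG_carrier.
Variables (R : realType) (n : nat).

Definition growth_weight (x : 'rV[R]_n) : R := 1 + \sum_(i < n) `|x ord0 i|.

Definition poly_growth (f : 'rV[R]_n -> R) : Prop :=
  exists (N : nat) (M : R), [/\ (0 < N)%N, 0 <= M
    & forall x, `|f x| <= M * growth_weight x ^+ N].

Definition PG_pred : {pred 'rV[R]_n -> R} :=
  fun f => `[< continuous f /\ poly_growth f >].

Record PG := MkPG { PG_fun :> 'rV[R]_n -> R; _ : PG_fun \in PG_pred }.

HB.instance Definition _ := [isSub for PG_fun].
HB.instance Definition _ := [Choice of PG by <:].

Lemma growth_weight_ge1 x : 1 <= growth_weight x.
Proof. by rewrite lerDl sumr_ge0. Qed.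

Lemma PG_predP f : reflect (continuous f /\ poly_growth f) (f \in PG_pred).
Proof. exact: asboolP. Qed.

Lemma poly_growth_bound (N1 N2 : nat) (M1 M2 : R) x : 0 <= M1 -> 0 <= M2 ->
  M1 * growth_weight x ^+ N1 + M2 * growth_weight x ^+ N2 <=
  (M1 + M2) * growth_weight x ^+ (N1 + N2).
Proof.
move=> M1_ge0 M2_ge0; have w1 := growth_weight_ge1 x.
rewrite mulrDl lerD// ler_wpM2l// ler_weXn2l// ?leq_addr ?leq_addl//.
Qed.

Lemma PG_submod_closed : submod_closed PG_pred.
Proof.
split=> [|a f g /PG_predP[cf [N1 [M1 [N1_gt0 M1_ge0 fM]]]]
                /PG_predP[cg [N2 [M2 [N2_gt0 M2_ge0 gM]]]]]; apply/PG_predP.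
  split; first exact: cst_continuous.
  by exists 1%N, 0; split=> // x; rewrite mul0r normr0.
split.
  move=> x; apply: continuousD; last exact: cg.
  by apply: continuousM; [exact: cst_continuous|exact: cf].
exists (N1 + N2)%N, (`|a| * M1 + M2).
split; [by rewrite addn_gt0 N1_gt0 | by rewrite addr_ge0// mulr_ge0 |move=> x].
apply: le_trans (poly_growth_bound _ _ _ _ _) => //; last by rewrite mulr_ge0.
apply: le_trans (ler_normD _ _) _; rewrite lerD// normrM -mulrA.
by rewrite ler_wpM2l.
Qed.

HB.instance Definition _ := GRing.isSubmodClosed.Build R _ PG_pred
  PG_submod_closed.
HB.instance Definition _ := [SubChoice_isSubLmodule of PG by <:].

HB.instance Definition _ := Order.SubChoice_isSubPOrder.Build
  _ _ PG_pred ring_display PG.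

Lemma PG_predW (f g h : 'rV[R]_n -> R) : f \in PG_pred -> g \in PG_pred ->
  continuous h -> (forall x, `|h x| <= `|f x| + `|g x|) -> h \in PG_pred.
Proof.
move=> /PG_predP[_ [N1 [M1 [N1_gt0 M1_ge0 fM]]]].
move=> /PG_predP[_ [N2 [M2 [N2_gt0 M2_ge0 gM]]]] ch hfg; apply/PG_predP.
split=> //; exists (N1 + N2)%N, (M1 + M2).
split; [by rewrite addn_gt0 N1_gt0 | by rewrite addr_ge0 | move=> x].
apply: le_trans (poly_growth_bound _ _ _ _ _) => //.
by apply: le_trans (hfg x) _; rewrite lerD.
Qed.

Lemma PG_min_subproof (f g : PG) :
  ((fun x => Num.min (f x) (g x)) : _ -> R) \in PG_pred.
Proof.
apply: (PG_predW (valP f) (valP g)) => [x|x /=].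
  have /PG_predP[cf _] := valP f; have /PG_predP[cg _] := valP g.
  by apply: continuous_min; [exact: cf|exact: cg].
by case: (ltP (f x) (g x)) => _; rewrite ?lerDl ?lerDr normr_ge0.
Qed.

Definition PG_min (f g : PG) : PG := MkPG (PG_min_subproof f g).

Lemma PG_max_subproof (f g : PG) :
  ((fun x => Num.max (f x) (g x)) : _ -> R) \in PG_pred.
Proof.
apply: (PG_predW (valP f) (valP g)) => [x|x /=].
  have /PG_predP[cf _] := valP f; have /PG_predP[cg _] := valP g.
  by apply: continuous_max; [exact: cf|exact: cg].
by case: (ltP (f x) (g x)) => _; rewrite ?lerDl ?lerDr normr_ge0.
Qed.

Definition PG_max (f g : PG) : PG := MkPG (PG_max_subproof f g).

Lemma PG_mul_subproof (f g : PG) : (f : _ -> R) \* g \in PG_pred.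
Proof.
case: f g => f /= /PG_predP[cf [N1 [M1 [N1_gt0 M1_ge0 fM]]]].
case=> g /= /PG_predP[cg [N2 [M2 [N2_gt0 M2_ge0 gM]]]]; apply/PG_predP.
split; first by move=> x; apply: continuousM; [exact: cf|exact: cg].
exists (N1 + N2)%N, (M1 * M2).
split; [by rewrite addn_gt0 N1_gt0 | by rewrite mulr_ge0 | move=> x].
by rewrite normrM exprD mulrACA ler_pM.
Qed.

Definition PG_mul (f g : PG) : PG := MkPG (PG_mul_subproof f g).

Lemma PG_one_subproof : (cst 1 : 'rV[R]_n -> R) \in PG_pred.
Proof.
apply/PG_predP; split; first exact: cst_continuous.
exists 1%N, 1; split=> // x.
by rewrite mul1r normr1 expr1 growth_weight_ge1.
Qed.

Definition PG_one : PG := MkPG PG_one_subproof.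

Lemma PG_coord_subproof (i : 'I_n) :
  ((fun x => x ord0 i) : 'rV[R]_n -> R) \in PG_pred.
Proof.
apply/PG_predP; split; first exact: coord_continuous.
exists 1%N, 1; split=> // x; rewrite mul1r expr1 /growth_weight (bigD1 i)//=.
by rewrite addrCA lerDl addr_ge0// sumr_ge0.
Qed.

(* Coordinates are numbered from 0. *)
Definition PG_coord (i : 'I_n) : PG := MkPG (PG_coord_subproof i).

Lemma PG_leP (f g : PG) : reflect (forall x, f x <= g x) (f <= g).
Proof. exact: lefP. Qed.

Lemma PG_ext (f g : PG) : (forall x, f x = g x) -> f = g.
Proof. by move=> fg; apply: val_inj; apply/funext. Qed.

Lemma PG_leD (f g h : PG) : f <= g -> f + h <= g + h.
Proof. by move=> /PG_leP fg; apply/PG_leP => x; rewrite lerD2r. Qed.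

Lemma PG_scale_ge0 (a : R) (f : PG) : 0 <= a -> 0 <= f -> 0 <= a *: f.
Proof.
by move=> a_ge0 /PG_leP f_ge0; apply/PG_leP => x; apply: mulr_ge0 (f_ge0 x).
Qed.

Lemma PG_minP (f g h : PG) : (h <= PG_min f g) = (h <= f) && (h <= g).
Proof.
apply/PG_leP/andP => [hfg|[/PG_leP hf /PG_leP hg] x]; last first.
  by rewrite le_min hf hg.
by split; apply/PG_leP => x; have := hfg x; rewrite le_min => /andP[].
Qed.

Lemma PG_maxP (f g h : PG) : (PG_max f g <= h) = (f <= h) && (g <= h).
Proof.
apply/PG_leP/andP => [hfg|[/PG_leP hf /PG_leP hg] x]; last first.
  by rewrite ge_max hf hg.
by split; apply/PG_leP => x; have := hfg x; rewrite ge_max => /andP[].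
Qed.

HB.instance Definition _ := isVectorLattice.Build R PG
  PG_minP PG_maxP PG_leD PG_scale_ge0.

Lemma PG_mulA : associative PG_mul.
Proof. by move=> f g h; apply: PG_ext => x; rewrite /= mulrA. Qed.

Lemma PG_mulDl : left_distributive PG_mul +%R.
Proof. by move=> f g h; apply: PG_ext => x; exact: mulrDl. Qed.

Lemma PG_mulDr : right_distributive PG_mul +%R.
Proof. by move=> f g h; apply: PG_ext => x; exact: mulrDr. Qed.

Lemma PG_mulZl (a : R) f g : PG_mul (a *: f) g = a *: PG_mul f g.
Proof. by apply: PG_ext => x; rewrite /= -scalerAl. Qed.

Lemma PG_mulZr (a : R) f g : PG_mul f (a *: g) = a *: PG_mul f g.
Proof. by apply: PG_ext => x; exact: mulrCA. Qed.

Lemma PG_mul_ge0 f g : 0 <= f -> 0 <= g -> 0 <= PG_mul f g.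
Proof.
move=> /PG_leP f_ge0 /PG_leP g_ge0; apply/PG_leP => x.
exact: mulr_ge0 (f_ge0 x) (g_ge0 x).
Qed.

HB.instance Definition _ := isLatticeAlgebra.Build R PG
  PG_mulA PG_mulDl PG_mulDr PG_mulZl PG_mulZr PG_mul_ge0.

End PG_carrier.

Section PGh_carrier.
Variables (R : realType) (n : nat).
Local Notation PG := (PG R n).

Definition radial_quotient (f : 'rV[R]_n -> R) (t : R) : 'rV[R]_n -> R :=
  fun x => f (t *: x) / t.

Definition radial_limit (f : 'rV[R]_n -> R) : 'rV[R]_n -> R :=
  fun x => lim (radial_quotient f t x @[t --> 0^'+]).

Definition radially_differentiable (f : 'rV[R]_n -> R) : Prop :=
  (forall x, cvg (radial_quotient f t x @[t --> 0^'+])) /\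
  (forall B : set 'rV[R]_n, bounded_set B ->
     {uniform B, radial_quotient f @ 0^'+ --> radial_limit f}).

Definition PGh_pred : {pred PG} := fun f => `[< radially_differentiable f >].

Record PGh := MkPGh { PGh_val :> PG; _ : PGh_val \in PGh_pred }.

HB.instance Definition _ := [isSub for PGh_val].
HB.instance Definition _ := [Choice of PGh by <:].

Lemma uniform_ballP (B : set 'rV[R]_n) (F : set_system ('rV[R]_n -> R))
    (g : 'rV[R]_n -> R) : Filter F ->
  {uniform B, F --> g} <->
  forall e : R, 0 < e -> \forall h \near F, forall x, B x -> `|h x - g x| < e.
Proof.
move=> FF; split=> [Fg e e_gt0|Fg W].
  apply: (Fg [set h | forall x, B x -> `|h x - g x| < e]).
  apply/uniform_nbhs.
  exists [set xy : R * R | ball xy.1 e xy.2].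
  split; first exact: entourage_ball (PosNum e_gt0).
  by move=> h /= hE x Bx; rewrite distrC; exact: hE.
move=> /uniform_nbhs[E [entE EW]].
have [e /= e_gt0 eE] : entourage_ (@ball R R) E by rewrite entourage_ballE.
apply: filterS (Fg _ e_gt0) => h hB; apply: EW => x Bx; apply: eE => /=.
by rewrite /ball /= distrC; exact: hB.
Qed.

Definition radial_cvg (f g : 'rV[R]_n -> R) : Prop :=
  forall B : set 'rV[R]_n, bounded_set B -> forall e : R, 0 < e ->
    \forall t \near 0^'+,
      forall x, B x -> `|radial_quotient f t x - g x| < e.

Lemma radially_differentiableP (f : 'rV[R]_n -> R) :
  radially_differentiable f <-> exists g, radial_cvg f g.
Proof.
split=> [[_ fl]|[g fg]].
  exists (radial_limit f) => B bB e e_gt0.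
  by have /uniform_ballP := fl B bB; apply.
have fgx x : radial_quotient f t x @[t --> 0^'+] --> g x.
  apply/cvgrPdist_lt => e e_gt0.
  have bx : bounded_set [set x].
    by exists `|x|; split; rewrite ?num_real// => M xM y ->; exact: ltW.
  apply: filterS (fg _ bx _ e_gt0) => t /(_ x erefl).
  by rewrite distrC.
split=> [x|B bB]; first by apply/cvg_ex; exists (g x).
have -> : radial_limit f = g by apply/funext => x; exact: cvg_lim (fgx x).
by apply/uniform_ballP => e e_gt0; exact: fg.
Qed.

Lemma PGh_predP (f : PG) :
  reflect (exists g, radial_cvg f g) (f \in PGh_pred).
Proof.
by apply: (iffP idP) => [/asboolP/radially_differentiableP//|fP];
  apply/asboolP/radially_differentiableP.
Qed.

Lemma PGh_submod_closed : submod_closed PGh_pred.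
Proof.
split=> [|a f g /PGh_predP[f' ff'] /PGh_predP[g' gg']]; apply/PGh_predP.
  exists (cst 0) => B _ e e_gt0; apply: nearW => t x _.
  by rewrite /radial_quotient mul0r subr0 normr0.
exists (fun x => a * f' x + g' x) => B bB e e_gt0.
have a1_gt0 : 0 < `|a| + 1 by rewrite ltr_wpDl.
have d_gt0 : 0 < e / 2 / (`|a| + 1) by rewrite !divr_gt0.
have e2_gt0 : 0 < e / 2 by rewrite divr_gt0.
apply: filterS2 (ff' B bB _ d_gt0) (gg' B bB _ e2_gt0) => t ft gt x Bx.
have -> : radial_quotient (a *: f + g : PG) t x - (a * f' x + g' x) =
    a * (radial_quotient f t x - f' x) + (radial_quotient g t x - g' x).
  rewrite /radial_quotient /=.
  rewrite [LHS](_ : _ = (a * f (t *: x) + g (t *: x)) / t - (a * f' x + g' x))//.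
  by rewrite /radial_quotient; ring.
apply: le_lt_trans (ler_normD _ _) _; rewrite normrM [e]splitr.
apply: ler_ltD; last exact: gt.
apply: (@le_trans _ _ ((`|a| + 1) * (e / 2 / (`|a| + 1)))); last first.
  by rewrite mulrC divfK// gt_eqF.
by apply: ler_pM => //; [rewrite lerDl|exact/ltW/ft].
Qed.

HB.instance Definition _ := GRing.isSubmodClosed.Build R _ PGh_pred
  PGh_submod_closed.
HB.instance Definition _ := [SubChoice_isSubLmodule of PGh by <:].
HB.instance Definition _ := Order.SubChoice_isSubPOrder.Build
  _ _ PGh_pred ring_display PGh.

Lemma dist_min_lt (a b c d e : R) : `|a - c| < e -> `|b - d| < e ->
  `|Num.min a b - Num.min c d| < e.
Proof.
rewrite !ltr_norml => /andP[? ?] /andP[? ?].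
by case: (leP a b) => ?; case: (leP c d) => ?; apply/andP; split; lra.
Qed.

Lemma dist_max_lt (a b c d e : R) : `|a - c| < e -> `|b - d| < e ->
  `|Num.max a b - Num.max c d| < e.
Proof.
rewrite !ltr_norml => /andP[? ?] /andP[? ?].
by case: (leP a b) => ?; case: (leP c d) => ?; apply/andP; split; lra.
Qed.

Lemma PGh_min_subproof (f g : PGh) : PG_min f g \in PGh_pred.
Proof.
have /PGh_predP[f' ff'] := valP f; have /PGh_predP[g' gg'] := valP g.
apply/PGh_predP; exists (fun x => Num.min (f' x) (g' x)) => B bB e e_gt0.
near=> t => x Bx.
rewrite /radial_quotient /= minr_pMl ?invr_ge0//.
apply: dist_min_lt; move: x Bx; near: t.
  exact: ff'.
exact: gg'.
Unshelve. all: by end_near. Qed.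

Definition PGh_min (f g : PGh) : PGh := MkPGh (PGh_min_subproof f g).

Lemma PGh_max_subproof (f g : PGh) : PG_max f g \in PGh_pred.
Proof.
have /PGh_predP[f' ff'] := valP f; have /PGh_predP[g' gg'] := valP g.
apply/PGh_predP; exists (fun x => Num.max (f' x) (g' x)) => B bB e e_gt0.
near=> t => x Bx.
rewrite /radial_quotient /= maxr_pMl ?invr_ge0//.
apply: dist_max_lt; move: x Bx; near: t.
  exact: ff'.
exact: gg'.
Unshelve. all: by end_near. Qed.

Definition PGh_max (f g : PGh) : PGh := MkPGh (PGh_max_subproof f g).

Lemma normr_coord_le (x : 'rV[R]_n) i : `|x ord0 i| <= `|x|.
Proof.
rewrite [leRHS]/Num.norm /= mx_normrE.
by apply/bigmax_geP; right => /=; exists (ord0, i).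
Qed.

Lemma poly_growth_bounded (f : 'rV[R]_n -> R) (B : set 'rV[R]_n) :
  poly_growth f -> bounded_set B -> exists K : R, forall x, B x -> `|f x| <= K.
Proof.
move=> [N [M [_ M_ge0 fM]]] [b [_ bB]].
exists (M * (1 + \sum_(i < n) (b + 1)) ^+ N) => x Bx.
apply: le_trans (fM x) _; rewrite ler_wpM2l// lerXn2r ?nnegrE//.
- by rewrite (le_trans _ (growth_weight_ge1 x)).
- have b1_ge0 : 0 <= b + 1.
    by apply: le_trans (bB _ _ x Bx) => //; rewrite ltrDl.
  by rewrite addr_ge0// sumr_ge0.
- rewrite lerD2l ler_sum// => i _; apply: le_trans (normr_coord_le x i) _.
  by apply: bB Bx; rewrite ltrDl.
Qed.

Lemma radial_cvg_bounded (f : PG) (g : 'rV[R]_n -> R) (B : set 'rV[R]_n) :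
  radial_cvg f g -> bounded_set B ->
  exists K : R, forall x, B x -> `|g x| <= K.
Proof.
move=> fg bB.
have [t] : exists t : R, 0 < t /\
    (forall x, B x -> `|radial_quotient f t x - g x| < 1).
  apply: (@filter_ex _ (0 : R)^'+).
  by near=> t; split=> //; near: t; exact: fg.
move=> [t_gt0 tB].
have btB : bounded_set [set t *: x | x in B].
  case: bB => b [_ bB]; exists (t * (b + 1)); split; first exact: num_real.
  move=> M tM _ [x Bx <-] /=; rewrite normrZ gtr0_norm//.
  apply: le_trans (ltW tM); apply: ler_wpM2l; first exact: ltW.
  by apply: bB Bx; rewrite ltrDl.
have /PG_predP[_ fgrowth] := valP f.
have [K fK] := poly_growth_bounded fgrowth btB.
exists (K / t + 1) => x Bx.
have gE : g x = radial_quotient f t x - (radial_quotient f t x - g x).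
  by rewrite opprB addrCA subrr addr0.
rewrite gE; apply: le_trans (ler_normB _ _) _; apply: lerD; last exact/ltW/tB.
rewrite normrM [`|t^-1|]gtr0_norm ?invr_gt0//.
by apply: ler_wpM2r; [rewrite invr_ge0 ltW|apply: fK; exists x].
Unshelve. all: by end_near. Qed.

Lemma PGh_mul_subproof (f g : PGh) : PG_mul f g \in PGh_pred.
Proof.
have /PGh_predP[f' ff'] := valP f; have /PGh_predP[g' gg'] := valP g.
apply/PGh_predP; exists (cst 0) => B bB e e_gt0.
have [K0 fK0] := radial_cvg_bounded ff' bB.
have [L0 gL0] := radial_cvg_bounded gg' bB.
pose K := `|K0| + 1; pose L := `|L0| + 1.
have K_gt0 : 0 < K by rewrite ltr_wpDl.
have L_gt0 : 0 < L by rewrite ltr_wpDl.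
near=> t.
have t_gt0 : 0 < t by [].
have fK x : B x -> `|radial_quotient f t x| <= K.
  move=> Bx.
  rewrite -(subrK (f' x) (radial_quotient f t x)) addrC.
  apply: le_trans (ler_normD _ _) _; apply: lerD.
    exact: le_trans (fK0 _ Bx) (ler_norm _).
  by apply: ltW; move: x Bx; near: t; exact: ff'.
have gL x : B x -> `|radial_quotient g t x| <= L.
  move=> Bx.
  rewrite -(subrK (g' x) (radial_quotient g t x)) addrC.
  apply: le_trans (ler_normD _ _) _; apply: lerD.
    exact: le_trans (gL0 _ Bx) (ler_norm _).
  by apply: ltW; move: x Bx; near: t; exact: gg'.
move=> x Bx; rewrite subr0.
have -> : radial_quotient (PG_mul f g) t x =
    t * (radial_quotient f t x * radial_quotient g t x).
  rewrite /radial_quotient /=; field; exact: lt0r_neq0.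
rewrite normrM (gtr0_norm t_gt0).
apply: (@le_lt_trans _ _ (t * (K * L))).
  apply: ler_wpM2l; first exact: ltW.
  by rewrite normrM; apply: ler_pM => //; [exact: fK|exact: gL].
rewrite -ltr_pdivlMr ?mulr_gt0//.
by near: t; apply: nbhs_right_lt; rewrite divr_gt0// mulr_gt0.
Unshelve. all: by end_near. Qed.

Definition PGh_mul (f g : PGh) : PGh := MkPGh (PGh_mul_subproof f g).

Lemma PGh_coord_subproof (i : 'I_n) : PG_coord R i \in PGh_pred.
Proof.
apply/PGh_predP; exists (PG_coord R i) => B _ e e_gt0; near=> t => x _.
have t_neq0 : t != 0 by rewrite gt_eqF.
by rewrite /radial_quotient /= mxE mulrAC divff// mul1r subrr normr0.
Unshelve. all: by end_near. Qed.

Definition PGh_coord (i : 'I_n) : PGh := MkPGh (PGh_coord_subproof i).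

Lemma PGh_minP (f g h : PGh) : (h <= PGh_min f g) = (h <= f) && (h <= g).
Proof. exact: PG_minP. Qed.

Lemma PGh_maxP (f g h : PGh) : (PGh_max f g <= h) = (f <= h) && (g <= h).
Proof. exact: PG_maxP. Qed.

Lemma PGh_leD (f g h : PGh) : f <= g -> f + h <= g + h.
Proof. exact: PG_leD. Qed.

Lemma PGh_scale_ge0 (a : R) (f : PGh) : 0 <= a -> 0 <= f -> 0 <= a *: f.
Proof. exact: PG_scale_ge0. Qed.

HB.instance Definition _ := isVectorLattice.Build R PGh
  PGh_minP PGh_maxP PGh_leD PGh_scale_ge0.

Lemma PGh_mulA : associative PGh_mul.
Proof. by move=> f g h; apply: val_inj; exact: PG_mulA. Qed.

Lemma PGh_mulDl : left_distributive PGh_mul +%R.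
Proof. by move=> f g h; apply: val_inj; exact: PG_mulDl. Qed.

Lemma PGh_mulDr : right_distributive PGh_mul +%R.
Proof. by move=> f g h; apply: val_inj; exact: PG_mulDr. Qed.

Lemma PGh_mulZl (a : R) f g : PGh_mul (a *: f) g = a *: PGh_mul f g.
Proof. by apply: val_inj; exact: PG_mulZl. Qed.

Lemma PGh_mulZr (a : R) f g : PGh_mul f (a *: g) = a *: PGh_mul f g.
Proof. by apply: val_inj; exact: PG_mulZr. Qed.

Lemma PGh_mul_ge0 f g : 0 <= f -> 0 <= g -> 0 <= PGh_mul f g.
Proof. exact: PG_mul_ge0. Qed.

HB.instance Definition _ := isLatticeAlgebra.Build R PGh
  PGh_mulA PGh_mulDl PGh_mulDr PGh_mulZl PGh_mulZr PGh_mul_ge0.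

End PGh_carrier.

(* Main.v *)
Require Import Defs.
From HB Require Import structures.
From mathcomp Require Import all_boot all_order all_algebra.
From mathcomp Require Import all_classical all_reals all_analysis.
From mathcomp Require Import ring lra.

Set Implicit Arguments.
Unset Strict Implicit.
Unset Printing Implicit Defensive.

Import Order.TTheory GRing.Theory Num.Theory.
Import numFieldNormedType.Exports.

Local Open Scope classical_set_scope.
Local Open Scope ring_scope.

(** Why the theorem holds.

    The functions in [PGh] are those whose blow-up at the origin, [F(t, x) =
    f(t x) / t], extends continuously to [t = 0]. The evaluations [f |-> F(t, x)]
    with [t >= 0] are linear lattice homomorphisms that are multiplicative up to
    the scalar [t]. In an Archimedean f-algebra [A], conversely, a real lattice
    homomorphism [phi] on a principal ideal satisfies [phi (y z) = t phi y phi z]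
    for some [t >= 0], because multiplications preserve bands
    ([functional_band_preserving]); and such characters separate points
    ([exists_character], by Zorn's lemma, through maximal, hence prime, ideals).
    So, for [a_1, ..., a_n] in [A], each character sees the algebra generated by
    the [a_i] as the evaluation of blow-ups at [(t, phi a_1, ..., phi a_n)]. This
    makes the relation [y = f(a)] well defined and compatible with all
    operations ([evaluates]).

    That [f(a)] exists for every [f] in [PGh], and that a homomorphism is
    determined by the [a_i], both rest on a density theorem ([PGh_dense]): up to
    errors relative to one polynomial weight, [f] is a lattice combination of
    the coordinates and of finitely many powers of [s], the sum of their absolute
    values. Apart from a truncation at infinity, this is the lattice form of the
    Stone-Weierstrass theorem ([lattice_stone_weierstrass]) for the blow-ups on
    the compact product of [[0, T]] and the unit sphere of [s]. Uniform
    completeness of [A] then provides [f(a)] as a limit ([evaluates_total]).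

    The algebra with identity [PG_n] is a quotient of [PGh_(n+1)]: restrict
    functions to the hyperplane where the first coordinate is 1. Multiplication
    by a cutoff in the first coordinate yields a section ([extend]), and every
    homomorphism on [PGh_(n+1)] that maps the first coordinate to an identity
    becomes, when composed with it, a homomorphism on [PG_n]
    ([hom_extend]). *)

(** * Vector lattices *)

Section vector_lattice_theory.
Context {R : realType} {X : vectorLatticeType R}.
Implicit Types (x y z e : X) (a b : R).

Lemma vlerD2r z x y : (x + z <= y + z) = (x <= y).
Proof.
apply/idP/idP => xy; last exact: vleD2r.
by have := vleD2r _ _ (- z) xy; rewrite !addrK.
Qed.

Lemma vlerD2l z x y : (z + x <= z + y) = (x <= y).
Proof. by rewrite ![z + _]addrC vlerD2r. Qed.

Lemma vlerD x y z t : x <= y -> z <= t -> x + z <= y + t.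
Proof.
by move=> xy zt; apply: (@le_trans _ _ (y + z)); rewrite ?vlerD2r ?vlerD2l.
Qed.

Lemma vsubr_ge0 x y : (0 <= y - x) = (x <= y).
Proof. by rewrite -[RHS](vlerD2r (- x)) subrr. Qed.

Lemma vlerN2 x y : (- x <= - y) = (y <= x).
Proof. by rewrite -[LHS]vsubr_ge0 opprK addrC vsubr_ge0. Qed.

Lemma vlerBlDr x y z : (x - y <= z) = (x <= z + y).
Proof. by rewrite -[LHS](vlerD2r y) subrK. Qed.

Lemma vlerBrDr x y z : (x <= y - z) = (x + z <= y).
Proof. by rewrite -[LHS](vlerD2r z) subrK. Qed.

Lemma vaddr_ge0 x y : 0 <= x -> 0 <= y -> 0 <= x + y.
Proof. by move=> x0 y0; rewrite -[0]addr0 vlerD. Qed.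

Lemma vlerDl x y : (x <= x + y) = (0 <= y).
Proof. by rewrite -[X in X <= _]addr0 vlerD2l. Qed.

Lemma vlerDr x y : (x <= y + x) = (0 <= y).
Proof. by rewrite addrC vlerDl. Qed.

Lemma voppr_le0 x : (- x <= 0) = (0 <= x).
Proof. by rewrite -[X in _ <= X]oppr0 vlerN2. Qed.

Lemma vlerZ a x y : 0 <= a -> x <= y -> a *: x <= a *: y.
Proof.
move=> a0; rewrite -vsubr_ge0 -(vsubr_ge0 (a *: x)) -scalerBr.
exact: vscale_ge0.
Qed.

Lemma vlerZr a b x : 0 <= x -> a <= b -> a *: x <= b *: x.
Proof. by move=> x0 ab; rewrite -vsubr_ge0 -scalerBl vscale_ge0 ?subr_ge0. Qed.

Lemma vlerZl_pos a x y : 0 < a -> (a *: x <= a *: y) = (x <= y).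
Proof.
move=> a0; apply/idP/idP => [|/vlerZ]; last by apply; exact: ltW.
move=> /(@vlerZ a^-1); rewrite invr_ge0 ltW// => /(_ isT).
by rewrite !scalerK// gt_eqF.
Qed.

Lemma vjoin_ubl x y : x <= vjoin x y.
Proof. by have := vjoinP x y (vjoin x y); rewrite lexx => /esym/andP[]. Qed.

Lemma vjoin_ubr x y : y <= vjoin x y.
Proof. by have := vjoinP x y (vjoin x y); rewrite lexx => /esym/andP[]. Qed.

Lemma vjoin_lub x y z : x <= z -> y <= z -> vjoin x y <= z.
Proof. by move=> xz yz; rewrite vjoinP xz. Qed.

Lemma vmeet_glb x y z : z <= x -> z <= y -> z <= vmeet x y.
Proof. by move=> xz yz; rewrite vmeetP xz. Qed.

Lemma vjoin_eqP x y z : (forall t, (z <= t) = (x <= t) && (y <= t)) -> z = vjoin x y.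
Proof.
move=> zP; apply/eqP; rewrite eq_le zP vjoin_ubl vjoin_ubr/= vjoinP.
by have := zP z; rewrite lexx => /esym/andP[-> ->].
Qed.

Lemma vjoinC x y : vjoin x y = vjoin y x.
Proof. by apply: vjoin_eqP => t; rewrite vjoinP andbC. Qed.

Lemma vjoin_r x y : x <= y -> vjoin x y = y.
Proof.
move=> xy; apply/esym/vjoin_eqP => t; apply/idP/andP => [yt|[]//].
by rewrite (le_trans xy).
Qed.

Lemma vjoinDr x y z : vjoin x y + z = vjoin (x + z) (y + z).
Proof. by apply: vjoin_eqP => t; rewrite -vlerBrDr vjoinP !vlerBrDr. Qed.

Lemma vmeetE x y : vmeet x y = - vjoin (- x) (- y).
Proof.
rewrite -[LHS]opprK; congr (- _); apply: vjoin_eqP => t.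
by rewrite -vlerN2 opprK vmeetP -[t in RHS]opprK !vlerN2.
Qed.

Lemma vjoinZ a x y : 0 <= a -> vjoin (a *: x) (a *: y) = a *: vjoin x y.
Proof.
rewrite le_eqVlt => /predU1P[<-|a0]; first by rewrite !scale0r vjoin_r.
apply/esym/vjoin_eqP => t; have tE : t = a *: (a^-1 *: t).
  by rewrite scalerA divff ?scale1r// gt_eqF.
by rewrite tE !vlerZl_pos// vjoinP.
Qed.

Lemma vmeetZ a x y : 0 <= a -> vmeet (a *: x) (a *: y) = a *: vmeet x y.
Proof. by move=> a0; rewrite !vmeetE scalerN -vjoinZ// !scalerN. Qed.

Lemma vmeetDr x y z : vmeet x y + z = vmeet (x + z) (y + z).
Proof.
rewrite !vmeetE !opprD -vjoinDr opprD opprK.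
by [].
Qed.

Definition vpos x : X := vjoin x 0.

Lemma vpos_ge0 x : 0 <= vpos x. Proof. exact: vjoin_ubr. Qed.

Lemma vpos_ge x : x <= vpos x. Proof. exact: vjoin_ubl. Qed.

Lemma vpos_le x y : (vpos x <= y) = (x <= y) && (0 <= y).
Proof. exact: vjoinP. Qed.

Lemma vpos_id x : 0 <= x -> vpos x = x.
Proof. by move=> x0; rewrite /vpos vjoinC vjoin_r. Qed.

Lemma vposN x : vpos (- x) = vpos x - x.
Proof. by rewrite /vpos vjoinDr subrr add0r vjoinC. Qed.

Lemma vpos_subN x : x = vpos x - vpos (- x).
Proof. by rewrite vposN opprB addrC subrK. Qed.

Lemma vmeet_posN x : vmeet (vpos x) (vpos (- x)) = 0.
Proof.
have -> : vpos x = 0 + vpos x by rewrite add0r.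
by rewrite vposN [vpos x - x]addrC -vmeetDr vmeetE oppr0 opprK vjoinC addNr.
Qed.

Lemma vabs_ge x : x <= vabs x. Proof. exact: vjoin_ubl. Qed.

Lemma vabs_geN x : - x <= vabs x. Proof. exact: vjoin_ubr. Qed.

Lemma vabs_le x y : (vabs x <= y) = (x <= y) && (- x <= y).
Proof. exact: vjoinP. Qed.

Lemma vabs_ge0 x : 0 <= vabs x.
Proof.
rewrite -(@vlerZl_pos 2%:R) ?ltr0n// scaler0 scaler_nat mulr2n -(subrr x).
by rewrite vlerD ?vabs_ge ?vabs_geN.
Qed.

Lemma vabs_id x : 0 <= x -> vabs x = x.
Proof. by move=> x0; rewrite /vabs vjoinC vjoin_r// (@le_trans _ _ 0)// voppr_le0. Qed.

Lemma vabsN x : vabs (- x) = vabs x.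
Proof. by rewrite /vabs opprK vjoinC. Qed.

Lemma vabsB x y : vabs (x - y) = vabs (y - x).
Proof. by rewrite -opprB vabsN. Qed.

Lemma vabs0 : vabs (0 : X) = 0. Proof. exact: vabs_id. Qed.

Lemma vabs_eq0 x : vabs x <= 0 -> x = 0.
Proof.
by rewrite vabs_le => /andP[x0]; rewrite voppr_le0 => x0'; apply/le_anti/andP.
Qed.

Lemma vabsD x y : vabs (x + y) <= vabs x + vabs y.
Proof. by rewrite vabs_le opprD !vlerD ?vabs_ge ?vabs_geN. Qed.

Lemma vabs_tri y x z : vabs (x - z) <= vabs (x - y) + vabs (y - z).
Proof. by rewrite -{1}(subrK y x) -addrA vabsD. Qed.

Lemma vabsZ_le a x : vabs (a *: x) <= `|a| *: vabs x.
Proof.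
have aux b y : b *: y <= `|b| *: vabs y.
  have [b0|b0] := leP 0 b; first by rewrite ger0_norm// vlerZ ?vabs_ge.
  rewrite ltr0_norm// -[b in X in X <= _]opprK scaleNr -scalerN.
  by rewrite vlerZ ?vabs_geN// oppr_ge0 ltW.
by rewrite vabs_le aux -scaleNr -(normrN a) aux.
Qed.

Lemma vpos_le_abs x : vpos x <= vabs x.
Proof. by rewrite vpos_le vabs_ge vabs_ge0. Qed.

Lemma vjoin_dist x y z t : vabs (vjoin x y - vjoin z t) <= vabs (x - z) + vabs (y - t).
Proof.
have aux (p q r s : X) : vjoin p q - vjoin r s <= vabs (p - r) + vabs (q - s).
  rewrite vlerBlDr; apply: vjoin_lub.
    rewrite -(subrK r p) vlerD ?vjoin_ubl// (le_trans (vabs_ge _))//.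
    by rewrite subrK vlerDl vabs_ge0.
  rewrite -(subrK s q) vlerD ?vjoin_ubr// (le_trans (vabs_ge _))//.
  by rewrite subrK vlerDr vabs_ge0.
by rewrite vabs_le aux opprB [vabs (x - _)]vabsB [vabs (y - _)]vabsB aux.
Qed.

Definition dominated (E x : X) := exists2 l : R, 0 <= l & vabs x <= l *: E.

Lemma dominated0 E : 0 <= E -> dominated E 0.
Proof. by exists 0 => //; rewrite vabs0 scale0r. Qed.

Lemma dominatedD E x y : dominated E x -> dominated E y -> dominated E (x + y).
Proof.
move=> [l l0 xl] [m m0 ym]; exists (l + m); first exact: addr_ge0.
by rewrite scalerDl (le_trans (vabsD _ _))// vlerD.
Qed.

Lemma dominatedZ E a x : dominated E x -> dominated E (a *: x).
Proof.
move=> [l l0 xl]; exists (`|a| * l); first exact: mulr_ge0.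
by rewrite -scalerA (le_trans (vabsZ_le _ _))// vlerZ.
Qed.

Lemma dominatedN E x : dominated E x -> dominated E (- x).
Proof. by rewrite /dominated vabsN. Qed.

Lemma dominatedB E x y : dominated E x -> dominated E y -> dominated E (x - y).
Proof. by move=> xE yE; apply: dominatedD => //; exact: dominatedN. Qed.

Lemma dominated_le E x y : vabs x <= vabs y -> dominated E y -> dominated E x.
Proof. by move=> xy [l l0 yl]; exists l => //; exact: le_trans yl. Qed.

Lemma dominated_abs E x : dominated E x -> dominated E (vabs x).
Proof. by apply: dominated_le; rewrite (vabs_id (vabs_ge0 _)). Qed.

Lemma dominated_pos E x : dominated E x -> dominated E (vpos x).
Proof. by apply: dominated_le; rewrite (vabs_id (vpos_ge0 _)) vpos_le_abs. Qed.

Lemma dominated_vjoin E x y : dominated E x -> dominated E y -> dominated E (vjoin x y).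
Proof.
move=> /dominated_abs xE /dominated_abs yE; apply: dominated_le (dominatedD xE yE).
have := vjoin_dist x y 0 0; rewrite (@vjoin_r 0)// !subr0.
by rewrite [vabs (_ + _)]vabs_id// vaddr_ge0 ?vabs_ge0.
Qed.

Lemma dominatedW E F x : E <= F -> dominated E x -> dominated F x.
Proof. by move=> EF [l l0 xl]; exists l => //; rewrite (le_trans xl)// vlerZ. Qed.

Lemma dominated_self E : 0 <= E -> dominated E E.
Proof. by move=> E0; exists 1; rewrite ?scale1r ?vabs_id. Qed.

Lemma principal_idealP e x : 0 <= e -> principal_ideal e x <-> dominated e x.
Proof.
move=> e0; split => [|[l l0 xl]].
  apply; split; last by move=> _ ->; exact: dominated_self.
  split; [exact: dominated0| |].
    by move=> a y z yE zE; apply: dominatedD => //; exact: dominatedZ.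
  by move=> y z zE yz; exact: dominated_le zE.
move=> I [[I0 IL IS] eI]; apply: (IS _ (l *: e)).
  by rewrite -[_ *: _]addr0; apply: IL => //; exact: eI.
by rewrite (vabs_id (vscale_ge0 _ _ l0 e0)).
Qed.

Lemma enorm_ub e x l : 0 <= l -> vabs x <= l *: e -> enorm e x <= l.
Proof. by move=> l0 xl; apply: ge_inf => //; exists 0 => m []. Qed.

Lemma enorm_ge0 e x : 0 <= enorm e x.
Proof.
rewrite /enorm; set S := [set l : R | _].
have [->|/set0P xE] := eqVneq S set0.
  by rewrite inf0.
by apply: lb_le_inf => // l [].
Qed.

Lemma enorm_lt e x l : 0 <= e -> dominated e x -> enorm e x < l -> vabs x <= l *: e.
Proof.
move=> e0 [m m0 xm] xl; have [|k [k0 xk] kl] := inf_lt _ xl.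
  by exists m.
by rewrite (le_trans xk)// vlerZr// ltW.
Qed.

End vector_lattice_theory.

(** * Relatively uniform convergence *)

(** Relatively uniform convergence replaces the norms of the principal ideals: it
    compares elements directly, without any infimum, and does not ask that the
    sequence itself lie in the ideal. *)
Section relatively_uniform.
Context {R : realType} {X : vectorLatticeType R}.
Implicit Types (x y z e : X) (a b : R) (u : nat -> X).

Definition ru_cauchy e u := forall eps : R, 0 < eps -> exists N : nat,
  forall p q : nat, (N <= p)%N -> (N <= q)%N -> vabs (u p - u q) <= eps *: e.

Definition ru_cvg e u l := forall eps : R, 0 < eps -> exists N : nat,
  forall p : nat, (N <= p)%N -> vabs (u p - l) <= eps *: e.

(** A sequence that is Cauchy relatively to [e] lies in the ideal of [e] once one
    of its late terms is subtracted from it. *)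
Lemma ru_completeP : (forall e, 0 <= e -> enorm_complete e) <->
  (forall e u, 0 <= e -> ru_cauchy e u -> exists l, ru_cvg e u l).
Proof.
split=> [cX e u e0 uC|cX e e0 u ue uC].
  have [N0 uN0] := uC 1 ltr01.
  pose v k := u (N0 + k)%N - u N0.
  have ve k : dominated e (v k).
    by exists 1 => //; apply: uN0 => //; rewrite leq_addr.
  have [k|eps eps0|l /principal_idealP le vl] := cX e e0 v.
  - by apply/principal_idealP.
  - have eps2 : 0 < eps / 2 by rewrite divr_gt0.
    have [N uN] := uC _ eps2; exists N => p q Np Nq.
    apply: le_lt_trans (_ : eps / 2 < eps); last first.
      by rewrite ltr_pdivrMr// ltr_pMr// ltr1n.
    apply: enorm_ub; first exact: ltW.
    rewrite /v opprB addrA subrK.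
    by apply: uN; rewrite (leq_trans _ (leq_addl _ _)).
  exists (l + u N0) => eps eps0.
  have /cvgrPdist_lt/(_ _ eps0)[N _ vN] := vl.
  exists (N0 + N)%N => p Np.
  have N0p : (N0 <= p)%N by rewrite (leq_trans _ Np)// leq_addr.
  have Npp : (N <= p - N0)%N by rewrite leq_subRL.
  have := vN _ Npp; rewrite /= sub0r normrN ger0_norm ?enorm_ge0//.
  move=> /(enorm_lt e0 (dominatedB (ve _) (le e0))).
  by rewrite /v subnKC// opprD addrCA addrC -addrA addrC -addrA addrC.
have [eps eps0|l ul] := cX e u e0.
  have [N uN] := uC _ eps0; exists N => p q Np Nq; apply: enorm_lt (uN _ _ Np Nq) => //.
  by apply: dominatedB; apply/principal_idealP.
have ule k : dominated e (u k - l) -> dominated e l.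
  move=> ukl; rewrite -(subKr (u k) l); apply: dominatedB => //.
  exact/principal_idealP.
exists l.
  apply/principal_idealP => //; have [N uN] := ul _ ltr01.
  by apply: (ule N); exists 1 => //; exact: uN.
apply/cvgrPdist_le => eps eps0.
have [N uN] := ul _ eps0; exists N => // p /= Np.
rewrite sub0r normrN ger0_norm ?enorm_ge0//; apply: enorm_ub; first exact: ltW.
exact: uN.
Qed.

Lemma arch_le0 x e : vl_archimedean X -> 0 <= e ->
  (forall eps : R, 0 < eps -> x <= eps *: e) -> x <= 0.
Proof.
move=> aX e0 xe; have : vpos x = 0.
  apply: (aX _ e); first exact: vpos_ge0.
  case=> [|k]; first by rewrite mulr0n.
  have k0 : 0 < (k.+1%:R : R)^-1 by rewrite invr_gt0 ltr0n.
  have : vpos x <= (k.+1%:R : R)^-1 *: e by rewrite vpos_le xe// vscale_ge0// ltW.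
  move=> /(@vlerZ _ _ k.+1%:R _ _ (ler0n _ _)).
  by rewrite scaler_nat scalerA divff ?pnatr_eq0// scale1r.
by move=> <-; exact: vpos_ge.
Qed.

Lemma arch_eq0 x e : vl_archimedean X -> 0 <= e ->
  (forall eps : R, 0 < eps -> vabs x <= eps *: e) -> x = 0.
Proof. by move=> aX e0 xe; apply/vabs_eq0/(arch_le0 aX e0). Qed.

End relatively_uniform.

(** * Real lattice homomorphisms *)

Section lattice_functionals.
Context {R : realType} {X : vectorLatticeType R}.
Implicit Types (x y z D : X) (K : set X).

(** These are the sets of all [x] whose positive part belongs to an order ideal
    that is prime or the whole space; [K x] reads as [x <= 0] in the totally
    ordered quotient. *)
Record prime_lower_set K : Prop := {
  prime_lower0 : K 0;
  prime_lowerD : forall x y z, K x -> K y -> z <= vpos x + vpos y -> K z;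
  prime_lowerVN : forall x, K x \/ K (- x) }.

(** An ideal that is maximal among those avoiding [u] is prime: if [x] and [-x]
    were both positive modulo the ideal, adjoining the positive part of either
    would capture [u], but these two positive parts are disjoint. *)
Lemma exists_prime_lower_set u : 0 <= u -> u <> 0 ->
  exists2 K, prime_lower_set K & ~ K u.
Proof.
move=> u0 un0.
pose P (K : set X) := ~ K u /\ forall x y z, K x -> K y -> z <= vpos x + vpos y -> K z.
(* [P] does not mention 0, so that it holds of the union of the empty chain. *)
have [F FP Ftot|K [[Ku KD] Kmax]] := @Zorn_bigcup _ P.
  split=> [[K FK Ku]|x y z [K FK Kx] [L FL Ly] zxy]; first by have [] := FP _ FK.
  have [KL|LK] := Ftot _ _ FK FL.
    by exists L => //; have [_ /(_ x y z)] := FP _ FL; apply => //; exact: KL.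
  by exists K => //; have [_ /(_ x y z)] := FP _ FK; apply => //; exact: LK.
have K0 : K 0.
  apply: contrapT => K0; apply: (Kmax [set x | x <= 0]).
    split=> [x Kx0|]; last by move=> /(_ 0 (lexx 0)).

    by case: K0; apply: (KD _ _ _ Kx0 Kx0); rewrite vaddr_ge0// vpos_ge0.
  split=> [/= u_le0|x y z x0 y0 /= zxy]; first by apply: un0; apply/le_anti/andP.
  apply: le_trans zxy _; rewrite -[X in _ <= X]addr0.
  by apply: vlerD; rewrite vpos_le lexx ?x0 ?y0.
have Kpos j j' : K j -> K j' -> K (vpos j + vpos j').
  by move=> Kj Kj'; apply: KD Kj Kj' _.
have posE (j j' : X) : vpos (vpos j + vpos j') = vpos j + vpos j'.
  by rewrite vpos_id// vaddr_ge0 ?vpos_ge0.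
have adjoin x : ~ K x ->
    exists j c, [/\ K j, 0 <= c & u <= vpos j + c *: vpos x].
  move=> Kx.
  pose K' := [set z | exists j c, [/\ K j, 0 <= c & z <= vpos j + c *: vpos x]].
  apply: contrapT => K'u; apply: (Kmax K').
    split=> [z Kz|]; first by exists z, 0; rewrite scale0r addr0 vpos_ge.
    move/(_ x); apply: contra_not Kx; apply.
    exists 0, 1; split=> //.
    by rewrite scale1r (le_trans (vpos_ge x))// vlerDr vpos_ge0.
  split=> // y y' z [j [c [Kj c0 yj]]] [j' [c' [Kj' c'0 y'j']]] zyy'.
  exists (vpos j + vpos j'), (c + c'); split; [exact: Kpos|exact: addr_ge0|].
  apply: le_trans zyy' _; rewrite posE scalerDl addrACA.
  by apply: vlerD; rewrite vpos_le ?yj ?y'j' vaddr_ge0 ?vpos_ge0 ?vscale_ge0 ?vpos_ge0.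
exists K => //; split=> // x; apply: contrapT => /not_orP[Kx KNx].
have [j [c [Kj c0 uj]]] := adjoin _ Kx.
have [j' [c' [Kj' c'0 uj']]] := adjoin _ KNx.
apply: Ku; apply: KD Kj Kj' _.
rewrite -[X in _ <= X]add0r -vlerBlDr.
(* The two bounds are multiples of disjoint elements. *)
have -> : 0 = vmeet ((c + c') *: vpos x) ((c + c') *: vpos (- x)).
  by rewrite vmeetZ ?addr_ge0// vmeet_posN scaler0.
apply: vmeet_glb; rewrite vlerBlDr addrC.
  apply: le_trans uj _; apply: vlerD; first by rewrite vlerDl vpos_ge0.
  by apply: vlerZr; rewrite ?vpos_ge0// lerDl.
apply: le_trans uj' _; apply: vlerD; first by rewrite vlerDr vpos_ge0.
by apply: vlerZr; rewrite ?vpos_ge0// lerDr.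
Qed.

Lemma prime_lowerW K x y : prime_lower_set K -> K x -> y <= x -> K y.
Proof.
move=> Kp Kx yx; apply: (prime_lowerD Kp Kx Kx) => //.
by rewrite (le_trans yx)// (le_trans (vpos_ge x))// vlerDl vpos_ge0.
Qed.

Lemma prime_lower_add K x y : prime_lower_set K -> K x -> K y -> K (x + y).
Proof.
by move=> Kp Kx Ky; apply: prime_lowerD Kx Ky _ => //; rewrite vlerD ?vpos_ge.
Qed.

Lemma prime_lower_pos K x : prime_lower_set K -> K x -> K (vpos x).
Proof.
move=> Kp Kx.
by apply: (prime_lowerD Kp Kx Kx) => //; rewrite vlerDl vpos_ge0.
Qed.

Lemma prime_lowerZ K x (c : R) : prime_lower_set K -> 0 <= c -> K x -> K (c *: x).
Proof.
move=> Kp c0 /(prime_lower_pos Kp) Kx.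
have Kn n : K (vpos x *+ n).
  elim: n => [|n IH]; first exact: prime_lower0.
  by rewrite mulrS; exact: prime_lower_add.
apply: prime_lowerW (Kn (Num.bound c)) _ => //.
rewrite -scaler_nat; apply: le_trans (vlerZ c0 (vpos_ge x)) _.
by apply: vlerZr; [exact: vpos_ge0|exact/ltW/archi_boundP].
Qed.

Lemma prime_lower_join K x y : prime_lower_set K -> K x -> K y -> K (vjoin x y).
Proof.
move=> Kp Kx Ky; apply: prime_lowerD Kx Ky _ => //; apply: vjoin_lub.
  by rewrite (le_trans (vpos_ge x))// vlerDl vpos_ge0.
by rewrite (le_trans (vpos_ge y))// vlerDr vpos_ge0.
Qed.

Record lattice_functional D (phi : X -> R) : Prop := {
  functional_lin : forall c x y, dominated D x -> dominated D y ->
    phi (c *: x + y) = c * phi x + phi y;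
  functional_join : forall x y, dominated D x -> dominated D y ->
    phi (vjoin x y) = Num.max (phi x) (phi y) }.

(** Modulo [K], the order is total and [D] is a strong unit of the ideal it
    generates, so every element of the ideal is infinitely close to exactly one
    real multiple of [D]; that multiple is the value of the functional. *)
Lemma functional_of_prime K D : 0 <= D -> prime_lower_set K -> ~ K D ->
  exists2 phi, lattice_functional D phi &
    forall x, dominated D x -> forall eps : R, 0 < eps ->
      K (vabs (x - phi x *: D) - eps *: D).
Proof.
move=> D0 Kp KD.
have KcD (c : R) : 0 < c -> ~ K (c *: D).
  move=> c0 KcD; apply: KD; rewrite -(scale1r D) -(mulVf (lt0r_neq0 c0)).
  by rewrite -scalerA; apply: prime_lowerZ => //; rewrite invr_ge0 ltW.
pose small w := forall eps : R, 0 < eps -> K (vabs w - eps *: D).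
have smallW w w' : vabs w <= vabs w' -> small w' -> small w.
  move=> ww' sw eps eps0; apply: prime_lowerW (sw _ eps0) _ => //.
  by rewrite vlerD2r.
have smallD w w' : small w -> small w' -> small (w + w').
  move=> sw sw' eps eps0; have e2 : 0 < eps / 2 by rewrite divr_gt0.
  apply: prime_lowerW (prime_lower_add Kp (sw _ e2) (sw' _ e2)) _ => //.
  by rewrite addrACA -opprD -scalerDl -splitr vlerD2r vabsD.
have smallZ (c : R) w : small w -> small (c *: w).
  move=> sw eps eps0; have c1 : 0 < `|c| + 1 by rewrite ltr_wpDl.
  have ec : 0 < eps / (`|c| + 1) by rewrite divr_gt0.
  have := prime_lowerZ Kp (ltW c1) (sw _ ec).
  move=> /(prime_lowerW Kp); apply.
  rewrite scalerBr scalerA [_ * (eps / _)]mulrC divfK ?gt_eqF// vlerD2r.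
  apply: le_trans (vabsZ_le _ _) _.
  by apply: vlerZr; rewrite ?vabs_ge0// lerDl.
pose near x r := small (x - r *: D).
have near_uniq x r s : near x r -> near x s -> r = s.
  move=> xr xs; apply: contrapT => /eqP rs.
  have srs : small ((s - r) *: D).
    have -> : (s - r) *: D = (x - r *: D) + (-1) *: (x - s *: D).
      by rewrite scaleN1r opprB scalerBl [RHS]addrC addrA subrK.
    by apply: smallD => //; exact: smallZ.
  have rs0 : 0 < `|s - r| by rewrite normr_gt0 subr_eq0 eq_sym.
  have rs2 : 0 < `|s - r| / 2 by rewrite divr_gt0.
  apply: (KcD _ rs2); apply: prime_lowerW (srs _ rs2) _ => //.
  rewrite vlerBrDr -scalerDl -splitr.
  have [h|h] := leP 0 (s - r); first by rewrite ger0_norm// vabs_ge.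
  by rewrite ltr0_norm// scaleNr vabs_geN.
have near_ex x : dominated D x -> exists r, near x r.
  move=> [l l0]; rewrite vabs_le => /andP[xl Nxl].
  pose S := [set r : R | K (r *: D - x)].
  have Sub : ubound S l.
    move=> r Sr; rewrite leNgt; apply/negP => lr.
    have : 0 < r - l by rewrite subr_gt0.
    move=> /KcD; apply; apply: prime_lowerW Sr _ => //.
    by rewrite scalerBl vlerD2l vlerN2.
  have SNl : S (- l).
    apply: prime_lowerW (prime_lower0 Kp) _ => //.
    by rewrite scaleNr vlerBlDr add0r -vlerN2 opprK.
  have Ssup : has_sup S by split; [exists (- l)|exists l].
  exists (sup S) => eps eps0.
  have [r Sr rS] := sup_adherent eps0 Ssup.
  rewrite /vabs vjoinDr; apply: prime_lower_join => //.
    have [//|] := prime_lowerVN Kp (x - sup S *: D - eps *: D).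
    rewrite -addrA -opprD -scalerDl opprB => SK.
    have : sup S + eps <= sup S by apply: sup_ubound => //; exists l.
    by rewrite gerDl leNgt eps0.
  apply: prime_lowerW Sr _ => //.
  by rewrite opprB addrAC -scalerBl vlerD2r vlerZr// ltW.
pose phi x := xget 0 [set r | near x r].
have phiP x : dominated D x -> near x (phi x).
  by move=> /near_ex[r xr]; rewrite /phi; exact: (xgetI 0 xr).
have phi_eq x r : dominated D x -> near x r -> phi x = r.
  by move=> xD xr; exact: near_uniq (phiP _ xD) xr.
exists phi => //; split=> [c x y xD yD|x y xD yD].
  apply: phi_eq; first by apply: dominatedD => //; exact: dominatedZ.
  rewrite /near.
  have -> : c *: x + y - (c * phi x + phi y) *: D =
      c *: (x - phi x *: D) + (y - phi y *: D).
    by rewrite scalerDl opprD addrACA scalerBr scalerA.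
  by apply: smallD (phiP _ yD); apply: smallZ (phiP _ xD).
apply: phi_eq; first exact: dominated_vjoin.
have maxE (r s : R) : Num.max r s *: D = vjoin (r *: D) (s *: D).
  have [rs|sr] := leP r s; first by rewrite vjoin_r// vlerZr.
  by rewrite vjoinC vjoin_r// vlerZr// ltW.
rewrite /near maxE => eps eps0; have e2 : 0 < eps / 2 by rewrite divr_gt0.
apply: prime_lowerW (prime_lower_add Kp (phiP _ xD _ e2) (phiP _ yD _ e2)) _ => //.
by rewrite addrACA -opprD -scalerDl -splitr vlerD2r vjoin_dist.
Qed.

Section functional_theory.
Variables (D : X) (phi : X -> R) (phiD : lattice_functional D phi) (D0 : 0 <= D).

Lemma functional0 : phi 0 = 0.
Proof.
have := functional_lin phiD 1 (dominated0 D0) (dominated0 D0).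
by rewrite scaler0 addr0 mul1r => /(congr1 (fun r => r - phi 0)); rewrite addrK subrr.
Qed.

Lemma functionalD x y : dominated D x -> dominated D y -> phi (x + y) = phi x + phi y.
Proof. by move=> xD yD; rewrite -[x]scale1r (functional_lin phiD)// mul1r scale1r. Qed.

Lemma functionalZ c x : dominated D x -> phi (c *: x) = c * phi x.
Proof.
move=> xD; rewrite -[_ *: x]addr0 (functional_lin phiD)//; last exact: dominated0.
by rewrite functional0 addr0.
Qed.

Lemma functionalN x : dominated D x -> phi (- x) = - phi x.
Proof. by move=> xD; rewrite -scaleN1r functionalZ// mulN1r. Qed.

Lemma functionalB x y : dominated D x -> dominated D y -> phi (x - y) = phi x - phi y.
Proof. by move=> xD yD; rewrite functionalD ?functionalN//; exact: dominatedN. Qed.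

Lemma functional_meet x y : dominated D x -> dominated D y ->
  phi (vmeet x y) = Num.min (phi x) (phi y).
Proof.
move=> xD yD; have NxD := dominatedN xD; have NyD := dominatedN yD.
rewrite vmeetE functionalN; last exact: dominated_vjoin.
by rewrite (functional_join phiD)// !functionalN// oppr_max !opprK.
Qed.

Lemma functional_le x y : dominated D x -> dominated D y -> x <= y -> phi x <= phi y.
Proof.
by move=> xD yD /vjoin_r xy; rewrite -[in leRHS]xy (functional_join phiD)// le_max lexx.
Qed.

Lemma functional_ge0 x : dominated D x -> 0 <= x -> 0 <= phi x.
Proof.
by move=> xD; rewrite -functional0; apply: functional_le => //; exact: dominated0.
Qed.

Lemma functional_abs x : dominated D x -> phi (vabs x) = `|phi x|.
Proof.
move=> xD; rewrite (functional_join phiD) ?functionalN//; last exact: dominatedN.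
by rewrite maxrN.
Qed.

Lemma functional_abs_le x y : dominated D x -> dominated D y ->
  vabs x <= y -> `|phi x| <= phi y.
Proof.
move=> xD yD xy; rewrite -functional_abs// functional_le//; exact: dominated_abs.
Qed.

(** Seen through a functional, a band preserving operator is multiplication by a
    number. The point is that [phi x = 0] entails [phi (T x) = 0]: for small
    [d > 0] the part of [x] above [d c] is disjoint from the part of [d c] above
    [x], on which [phi] is positive; the operator keeps them disjoint, so that
    [phi] vanishes at the image of the former. *)
Lemma functional_band_preserving (T : X -> X) (E c : X) :
  linear T -> (forall x, 0 <= x -> 0 <= T x) ->
  (forall x y, vmeet x y = 0 -> vmeet (T x) y = 0) ->
  E <= D -> (forall x, dominated E x -> dominated D (T x)) ->
  dominated E c -> 0 <= c -> phi c = 1 ->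
  forall x, dominated E x -> phi (T x) = phi x * phi (T c).
Proof.
move=> Tlin Tpos Tband ED TD cE c0 phic.
have TB x y : T (x - y) = T x - T y.
  by rewrite -scaleN1r addrC Tlin scaleN1r addrC.
have T0 : T 0 = 0 by have := TB 0 0; rewrite !subrr.
have TZ a x : T (a *: x) = a *: T x by rewrite -[a *: x]addr0 Tlin T0 addr0.
have Tle x y : x <= y -> T x <= T y.
  by move=> xy; rewrite -vsubr_ge0 -TB Tpos// vsubr_ge0.
have WE x : dominated E x -> dominated D x by exact: dominatedW.
have ann x : dominated E x -> 0 <= x -> phi x = 0 -> phi (T x) = 0.
  move=> xE x0 phix; apply/le_anti/andP; split; last first.
    by apply: functional_ge0; [exact: TD|exact: Tpos].
  apply/ler_addgt0Pl => eps eps0; rewrite addr0.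
  pose d := eps / (phi (T c) + 1).
  have Tc0 : 0 <= phi (T c) by apply: functional_ge0; [exact: TD|exact: Tpos].
  have d0 : 0 < d by rewrite divr_gt0// ltr_wpDl.
  pose p := x - d *: c.
  have pE : dominated E p by apply: dominatedB => //; exact: dominatedZ.
  have phip : phi (vpos (- p)) = d.
    rewrite (functional_join phiD) ?functional0; last 2 first.
    - by apply/WE; exact: dominatedN.
    - exact: dominated0.
    rewrite functionalN; last exact: WE.
    rewrite functionalB ?functionalZ ?phix ?phic; [|exact: WE..|by apply/WE/dominatedZ].
    by rewrite sub0r opprK mulr1 max_l// ltW.
  have Tp : phi (T (vpos p)) <= 0.
    have /(congr1 phi) := Tband _ _ (vmeet_posN p).
    rewrite functional0 functional_meet ?phip; last 2 first.
    - exact/TD/dominated_pos.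
    - exact/WE/dominated_pos/dominatedN.
    case: (leP (phi (T (vpos p))) d) => [_ ->//|_ d_eq0].
    by move: d0; rewrite d_eq0 ltxx.
  have Tx : T x <= T (vpos p) + d *: T c.
    by rewrite -TZ -vlerBlDr -TB Tle// vpos_ge.
  have TpD : dominated D (T (vpos p)) by exact/TD/dominated_pos.
  have dTc : dominated D (d *: T c) by exact/dominatedZ/TD.
  have := functional_le (TD _ xE) (dominatedD TpD dTc) Tx.
  rewrite functionalD// functionalZ; last exact: TD.
  move=> /le_trans; apply; rewrite -[leRHS]add0r lerD// /d mulrAC.
  rewrite ler_pdivrMr ?ltr_wpDl// ler_wpM2l// ?lerDl//; exact: ltW.
have annE x : dominated E x -> phi x = 0 -> phi (T x) = 0.
  move=> xE phix; apply/eqP; rewrite -normr_le0.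
  have <- : phi (T (vabs x)) = 0.
    apply: ann; [exact: dominated_abs|exact: vabs_ge0|].
    by rewrite functional_abs ?phix ?normr0//; exact: WE.
  apply: functional_abs_le; [exact: TD|exact/TD/dominated_abs|].
  rewrite vabs_le Tle ?vabs_ge//=.
  by rewrite -sub0r -{1}T0 -TB sub0r Tle// vabs_geN.
move=> x xE; have cD := WE _ cE; have xD := WE _ xE.
have xcE : dominated E (phi x *: c) by exact: dominatedZ.
have phi0 : phi (x - phi x *: c) = 0.
  by rewrite (functionalB xD (dominatedZ _ cD)) functionalZ// phic mulr1 subrr.
have := annE _ (dominatedB xE xcE) phi0.
rewrite TB TZ (functionalB (TD _ xE) (dominatedZ _ (TD _ cE))) functionalZ.
  by move/eqP; rewrite subr_eq0 => /eqP.
exact: TD.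
Qed.

End functional_theory.
End lattice_functionals.

(** * Characters of f-algebras *)

Section characters.
Context {R : realType} {A : latticeAlgebraType R}.
Implicit Types (x y z E : A).

Lemma amulNl x y : amul (- x) y = - amul x y.
Proof. by rewrite -scaleN1r amulZl scaleN1r. Qed.

Lemma amulNr x y : amul x (- y) = - amul x y.
Proof. by rewrite -scaleN1r amulZr scaleN1r. Qed.

Lemma amulBl x y z : amul (x - y) z = amul x z - amul y z.
Proof. by rewrite amulDl amulNl. Qed.

Lemma amulBr x y z : amul x (y - z) = amul x y - amul x z.
Proof. by rewrite amulDr amulNr. Qed.

Lemma amul_le x y z t : 0 <= x -> 0 <= z -> x <= y -> z <= t -> amul x z <= amul y t.
Proof.
move=> x0 z0 xy zt; apply: (@le_trans _ _ (amul x t)).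
  by rewrite -vsubr_ge0 -amulBr amul_ge0// vsubr_ge0.
by rewrite -vsubr_ge0 -amulBl amul_ge0 ?vsubr_ge0// (le_trans z0).
Qed.

Lemma vabs_amul x y : vabs (amul x y) <= amul (vabs x) (vabs y).
Proof.
have aux z t : amul z t <= amul (vabs z) (vabs t).
  have p1 : 0 <= amul (vabs z - z) (vabs t + t).
    by rewrite amul_ge0 ?vsubr_ge0 ?vabs_ge// -[t in _ + t]opprK vsubr_ge0 vabs_geN.
  have p2 : 0 <= amul (vabs z + z) (vabs t - t).
    by rewrite amul_ge0 ?vsubr_ge0 ?vabs_ge// -[z in _ + z]opprK vsubr_ge0 vabs_geN.
  rewrite -vsubr_ge0 -(@vlerZl_pos _ _ 2%:R) ?ltr0n// scaler0 scaler_nat mulr2n.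
  have := vaddr_ge0 p1 p2.
  rewrite amulBl amulDl !amulDr !amulNr addrACA opprD.
  set a := amul (vabs z) (vabs t); set b := amul (vabs z) t.
  set c := amul z (vabs t); set d := amul z t.
  by rewrite (addrACA a) subrr addr0 (addrACA (- c)) addNr add0r addrACA.
by rewrite vabs_le aux -amulNl -(vabsN x) aux.
Qed.

Lemma dominated_amul E F x y : 0 <= E -> 0 <= F ->
  dominated E x -> dominated F y -> dominated (amul E F) (amul x y).
Proof.
move=> E0 F0 [l l0 xl] [m m0 ym]; exists (l * m); first exact: mulr_ge0.
apply: le_trans (vabs_amul _ _) _.
by rewrite -scalerA -amulZr -amulZl amul_le ?vabs_ge0.
Qed.

(** A real lattice homomorphism is multiplicative only up to a scalar [t], which
    vanishes when the homomorphism kills all products. It is a homomorphism on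
    the ideal of [E] only; the products of two elements of this ideal may lie
    outside of it, and its remaining values are arbitrary. *)
Record character E (phi : A -> R) (t : R) : Prop := {
  character_functional : lattice_functional E phi;
  character_scale_ge0 : 0 <= t;
  character_mul : forall x y, dominated E x -> dominated E y ->
    phi (amul x y) = t * (phi x * phi y) }.

Lemma characterW E F phi t : E <= F -> character F phi t -> character E phi t.
Proof.
move=> EF [[phil phij] t0 phim].
have W x : dominated E x -> dominated F x by exact: dominatedW.
by split=> // [|x y xE yE]; [split=> [c|] x y xE yE|]; auto.
Qed.

(** The functional is built on the ideal of [E + E E], which contains all products
    of elements of the ideal of [E]. As left and right multiplications preserve
    bands, [phi (x z) = phi x phi z phi (c c)] whenever [phi c = 1]. The
    Archimedean property is what yields a functional that is negative at [y]. *)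
Lemma exists_character E y : f_algebra A -> vl_archimedean A ->
  0 <= E -> dominated E y -> ~ 0 <= y ->
  exists phi t, character E phi t /\ phi y < 0.
Proof.
move=> fA aA E0 yE y0.
pose D := E + amul E E; pose v := vpos (- y).
have EE0 : 0 <= amul E E by exact: amul_ge0.
have ED : E <= D by rewrite vlerDl.
have D0 : 0 <= D by exact: le_trans ED.
have WE x : dominated E x -> dominated D x by exact: dominatedW.
have vE : dominated E v by exact/dominated_pos/dominatedN.
have vn0 : v <> 0.
  by move=> v0; apply: y0; rewrite (vpos_subN y) -/v v0 subr0 vpos_ge0.
have [k kv] : exists k : nat, ~ v *+ k <= D.
  apply: contrapT => /forallNP kD; apply: vn0; apply: (aA _ D); first exact: vpos_ge0.
  by move=> k; apply: contrapT; exact: kD.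
pose u := vpos (v *+ k - D).
have un0 : u <> 0.
  by move=> u0; apply: kv; rewrite -[X in _ <= X]add0r -vlerBlDr -u0 vpos_ge.
have [K Kp Ku] := exists_prime_lower_set (vpos_ge0 _) un0.
have KD : ~ K D.
  move: vE => [l l0 vl].
  move=> /(prime_lowerZ Kp (mulr_ge0 (ler0n R k) l0)) KD; apply: Ku.
  apply: prime_lower_pos => //; apply: prime_lowerW KD _ => //.
  rewrite vlerBlDr -[X in X <= _]addr0 vlerD// -scalerA -scaler_nat vlerZ//.
  by rewrite (le_trans (vabs_ge _))// (le_trans vl)// vlerZ.
have [phi phiD phiK] := functional_of_prime D0 Kp KD.
have phiv : 0 < phi v.
  have v0 : 0 <= phi v by apply: (functional_ge0 phiD); [|exact: WE|exact: vpos_ge0].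
  rewrite lt_neqAle v0 andbT eq_sym; apply/eqP => phiv.
  case: (posnP k) => [k0|k0]; first by apply: kv; rewrite k0 mulr0n.
  have k1 : 0 < (k%:R : R)^-1 by rewrite invr_gt0 ltr0n.
  have := phiK _ (WE _ vE) _ k1.
  rewrite phiv scale0r subr0 => /(prime_lowerZ Kp (ler0n R k)).
  rewrite scalerBr scalerA divff ?pnatr_eq0 -?lt0n// scale1r scaler_nat => Kv.
  apply: Ku; apply: prime_lower_pos => //; apply: prime_lowerW Kv _ => //.
  by rewrite vlerD2r vabs_id ?vpos_ge0.
have phiy : phi y < 0.
  have vy : v <= vpos (- y) by [].
  have : phi v = Num.max (- phi y) 0.
    rewrite (functional_join phiD) ?(functional0 phiD)// ?(functionalN phiD)//.
    - exact: WE.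
    - exact/dominatedN/WE.
    - exact: dominated0.
  by move: phiv => /[swap] ->; rewrite lt_max ltxx orbF oppr_gt0.
pose c := (phi v)^-1 *: v.
have cE : dominated E c by exact: dominatedZ.
have c0 : 0 <= c by apply: vscale_ge0; [rewrite invr_ge0 ltW|exact: vpos_ge0].
have phic : phi c = 1.
  by rewrite (functionalZ phiD)// ?mulVf ?gt_eqF//; exact: WE.
have DM x z : dominated E x -> dominated E z -> dominated D (amul x z).
  move=> xE zE; apply: dominatedW (dominated_amul E0 E0 xE zE).
  by rewrite vlerDr.
have phi_left x z : dominated E x -> dominated E z -> 0 <= x ->
    phi (amul x z) = phi z * phi (amul x c).
  move=> xE zE x0.
  apply: (@functional_band_preserving _ _ D phi phiD D0 (amul x) E c) => //.
  - by move=> a p q; rewrite amulDr amulZr.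
  - by move=> p; exact: amul_ge0.
  - by move=> p q pq; have [] := fA p q x pq x0.
  - by move=> p; exact: DM.
have phi_right x : dominated E x -> phi (amul x c) = phi x * phi (amul c c).
  move=> xE.
  apply: (@functional_band_preserving _ _ D phi phiD D0 (fun x => amul x c) E c) => //.
  - by move=> a p q; rewrite amulDl amulZl.
  - by move=> p p0; exact: amul_ge0.
  - by move=> p q pq; have [] := fA p q c pq c0.
  - by move=> p pE; exact: DM.
exists phi, (phi (amul c c)); split=> //; split.
- split=> [a x z xE zE|x z xE zE].
    by apply: (functional_lin phiD); exact: WE.
  by apply: (functional_join phiD); exact: WE.
- by apply: (functional_ge0 phiD); [|exact: DM|exact: amul_ge0].
- move=> x z xE zE.
  have xpE := dominated_pos xE; have xnE := dominated_pos (dominatedN xE).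
  rewrite {1}(vpos_subN x) amulBl (functionalB phiD)//; [|exact: DM..].
  rewrite (phi_left _ z)// ?vpos_ge0// (phi_left (vpos (- x)) z)// ?vpos_ge0//.
  rewrite -mulrBr -(functionalB phiD)//; [|exact: DM..].
  by rewrite -amulBl -vpos_subN phi_right//; ring.
Qed.

End characters.

(** * The blow-up of a function at the origin *)

Section blowup.
Variables (R : realType) (n : nat).
Implicit Types (f g : PGh R n) (x y : 'rV[R]_n) (t : R).

(** The functions of [PGh] are those that become continuous on [[0, oo[ x R^n]
    in the coordinates [(t, x)] with [y = t x], after division by [t]; the value
    at [t = 0] is the radial derivative. The constant extension to [t < 0] makes
    the blow-up continuous on the whole space. *)
Definition blowup (f : 'rV[R]_n -> R) (z : R * 'rV[R]_n) : R :=
  if 0 < z.1 then radial_quotient f z.1 z.2 else radial_limit f z.2.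

Lemma radial_limit_uniform f : radial_cvg f (radial_limit f).
Proof.
have /asboolP[_ fu] := valP f.
by move=> B bB e e0; have /uniform_ballP := fu B bB; apply.
Qed.

Lemma radial_limit_cvg f x :
  radial_quotient f t x @[t --> 0^'+] --> radial_limit f x.
Proof. by have /asboolP[fl _] := valP f; exact: fl. Qed.

Lemma radial_limit_unique f x (l : R) :
  radial_quotient f t x @[t --> 0^'+] --> l -> radial_limit f x = l.
Proof. exact: cvg_lim. Qed.

Lemma blowup_lin (a : R) f g z :
  blowup (a *: f + g : PGh R n) z = a * blowup f z + blowup g z.
Proof.
have rq t x : radial_quotient (a *: f + g : PGh R n) t x =
    a * radial_quotient f t x + radial_quotient g t x.
  by rewrite /radial_quotient mulrA -mulrDl.
rewrite /blowup; case: ltP => // _; apply: radial_limit_unique.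
under eq_fun do rewrite rq.
by apply: cvgD; [apply: cvgMl_tmp|]; exact: radial_limit_cvg.
Qed.

Lemma blowup_max f g z :
  blowup (vjoin f g) z = Num.max (blowup f z) (blowup g z).
Proof.
have rq t x : 0 < t -> radial_quotient (vjoin f g) t x =
    Num.max (radial_quotient f t x) (radial_quotient g t x).
  by move=> t0; rewrite /radial_quotient -maxr_pMl// invr_ge0 ltW.
rewrite /blowup; case: ltP => [z0|_]; first exact: rq.
apply: radial_limit_unique.
apply/cvgrPdist_lt => e e0; near=> t.
rewrite rq//; apply: dist_max_lt; near: t.
  by have /cvgrPdist_lt := @radial_limit_cvg f z.2; exact.
by have /cvgrPdist_lt := @radial_limit_cvg g z.2; exact.
Unshelve. all: by end_near. Qed.

(** The blow-up at [(t, x)] is thus a character of scale [t]. *)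
Lemma blowup_mul f g t x : 0 <= t ->
  blowup (amul f g) (t, x) = t * (blowup f (t, x) * blowup g (t, x)).
Proof.
have rq s : 0 < s -> radial_quotient (amul f g) s x =
    s * (radial_quotient f s x * radial_quotient g s x).
  by move=> s0; rewrite /radial_quotient /=; field; rewrite gt_eqF.
rewrite le_eqVlt => /predU1P[<-|t0]; last by rewrite /blowup t0; exact: rq.
have -> : blowup (amul f g) (0, x) = radial_limit (amul f g) x.
  by rewrite /blowup ltxx.
have -> : blowup f (0, x) = radial_limit f x by rewrite /blowup ltxx.
have -> : blowup g (0, x) = radial_limit g x by rewrite /blowup ltxx.
apply: radial_limit_unique.
have lim0 : s * (radial_quotient f s x * radial_quotient g s x) @[s --> 0^'+] -->
    0 * (radial_limit f x * radial_limit g x).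
  apply: cvgM; first by apply: cvg_at_right_filter; exact: cvg_id.
  by apply: cvgM; exact: radial_limit_cvg.
apply: cvg_trans lim0; apply: near_eq_cvg; near=> s.
by rewrite rq.
Unshelve. all: by end_near. Qed.

Lemma blowup_coord i z : blowup (PGh_coord R i) z = z.2 ord0 i.
Proof.
have rq t x : 0 < t -> radial_quotient (PGh_coord R i) t x = x ord0 i.
  by move=> t0; rewrite /radial_quotient /= mxE mulrAC divff ?mul1r// gt_eqF.
rewrite /blowup; case: ltP => [z0|_]; first exact: rq.
apply: radial_limit_unique.
apply: cvg_near_cst; near=> t.
by rewrite rq.
Unshelve. all: by end_near. Qed.

Lemma blowupE f t x : 0 < t -> f (t *: x) = t * blowup f (t, x).
Proof. by move=> t0; rewrite /blowup t0 /radial_quotient mulrC divfK ?gt_eqF. Qed.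

Lemma blowup0 z : blowup (0 : PGh R n) z = 0.
Proof.
have := blowup_lin 1 (0 : PGh R n) 0 z; rewrite scaler0 addr0 mul1r.
by move=> /(congr1 (fun r => r - blowup (0 : PGh R n) z)); rewrite addrK subrr.
Qed.

Lemma blowupN f z : blowup (- f : PGh R n) z = - blowup f z.
Proof. by rewrite -[- f]addr0 -scaleN1r blowup_lin blowup0 mulN1r addr0. Qed.

Lemma blowup_min f g z :
  blowup (vmeet f g) z = Num.min (blowup f z) (blowup g z).
Proof.
by rewrite vmeetE blowupN blowup_max !blowupN oppr_max !opprK.
Qed.

Lemma blowup_ge0 f z : 0 <= f -> 0 <= blowup f z.
Proof.
move=> f0; have fE : vjoin 0 f = f by rewrite vjoin_r.
by have := blowup_max 0 f z; rewrite fE blowup0 => ->; rewrite le_max lexx.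
Qed.

Lemma blowup_dist f g h (eps : R) z : vabs (f - g) <= eps *: h ->
  `|blowup f z - blowup g z| <= eps * blowup h z.
Proof.
rewrite -vsubr_ge0 => /(blowup_ge0 z).
have -> : f - g = 1 *: f + - g by rewrite scale1r.
rewrite /vabs blowup_lin blowupN blowup_max blowupN blowup_lin blowupN mul1r.
by rewrite maxrN subr_ge0.
Qed.

Lemma PGh_at0 f : f 0 = 0.
Proof.
have cf := @radial_limit_cvg f 0.
have : t * radial_quotient f t 0 @[t --> 0^'+] --> 0 * radial_limit f 0.
  by apply: cvgM cf; apply: cvg_at_right_filter; exact: cvg_id.
have : t * radial_quotient f t 0 @[t --> 0^'+] --> f 0.
  apply: cvg_near_cst; near=> t.
  by rewrite /radial_quotient scaler0 mulrC divfK// gt_eqF.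
rewrite mul0r => c1 c2; exact: (cvg_unique _ c1 c2).
Unshelve. all: by end_near. Qed.

Lemma PGh_continuous f : continuous f.
Proof. by have /PG_predP[] := valP (f : PG R n). Qed.

Lemma radial_uniform_ball f x (e : R) : 0 < e ->
  exists2 d : R, 0 < d & forall t y, 0 < t -> t < d -> `|x - y| < 1 ->
    `|radial_quotient f t y - radial_limit f y| < e.
Proof.
move=> e0; have bB : bounded_set [set y : 'rV[R]_n | `|x - y| < 1].
  exists (`|x| + 1); split; first exact: num_real.
  move=> M xM y /= xy; apply: le_trans (ltW xM).
  rewrite -(subKr x y); apply: le_trans (ler_normB _ _) _.
  by rewrite lerD2l ltW.
have [d /= d0 dP] := @radial_limit_uniform f _ bB _ e0.
exists d => // t y t0 td xy; apply: (dP t) => //=.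
by rewrite /ball/= sub0r normrN gtr0_norm.
Qed.

Lemma radial_quotient_continuous f t : continuous (radial_quotient f t).
Proof.
move=> x; have ft : f (t *: y) @[y --> x] --> f (t *: x).
  apply: (continuous_comp (f := fun y : 'rV[R]_n => t *: y)).
    exact: scaler_continuous.
  exact: PGh_continuous.
exact: cvgMr_tmp ft.
Qed.

(** The radial limit is locally a uniform limit of continuous functions. *)
Lemma radial_limit_continuous f : continuous (radial_limit f).
Proof.
suff fx (x : 'rV[R]_n) : radial_limit f y @[y --> x] --> radial_limit f x.
  by move=> x; exact: fx.
apply/(@cvgrPdist_lt _ _ _ (nbhs x) (nbhs_filter x)) => e e0.
have e3 : 0 < e / 3 by rewrite divr_gt0.
have [d d0 dP] := @radial_uniform_ball f x _ e3.
pose t := d / 2; have t0 : 0 < t by rewrite divr_gt0.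
have td : t < d by rewrite /t ltr_pdivrMr// ltr_pMr// ltr1n.
near=> y.
have xy : `|x - y| < 1 by near: y; apply: cvgr_dist_lt.
have h1 := dP t y t0 td xy.
have h2 : `|radial_quotient f t x - radial_limit f x| < e / 3.
  by apply: dP => //; rewrite subrr normr0.
have h3 : `|radial_quotient f t x - radial_quotient f t y| < e / 3.
  by near: y; move/cvgrPdist_lt : (@radial_quotient_continuous f t x); exact.
move: h1 h2 h3; rewrite !ltr_norml => /andP[? ?] /andP[? ?] /andP[? ?].
by apply/andP; split; lra.
Unshelve. all: by end_near. Qed.

Lemma blowup_continuous f : continuous (blowup f).
Proof.
suff fz (t0 : R) (x0 : 'rV[R]_n) : blowup f z @[z --> (t0, x0)] --> blowup f (t0, x0).
  by move=> [t0 x0]; exact: fz.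
have [t0_gt0|t0_le0] := ltP 0 t0.
  have : radial_quotient f z.1 z.2 @[z --> (t0, x0)] --> blowup f (t0, x0).
    rewrite /blowup t0_gt0 /radial_quotient; apply: cvgM.
      apply: (@continuous_comp _ _ _ (fun z : R * 'rV[R]_n => z.1 *: z.2) f).
        by apply: cvgZ; [exact: cvg_fst|exact: cvg_snd].
      exact: PGh_continuous.
    by apply: cvgV; [rewrite gt_eqF|exact: cvg_fst].
  apply: cvg_trans; apply: near_eq_cvg.
  near=> z; rewrite /blowup ifT//; near: z.
  exact: (@cvg_fst _ _ (nbhs t0) (nbhs x0) _ [set t | 0 < t] (lt_nbhsr t0_gt0)).
apply/(@cvgrPdist_lt _ _ _ (nbhs (t0, x0)) (nbhs_filter (t0, x0))) => e e0.
have e2 : 0 < e / 2 by rewrite divr_gt0.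
have [d d0 dP] := @radial_uniform_ball f x0 _ e2.
near=> z.
have xy : `|x0 - z.2| < 1.
  near: z; apply: (@cvg_snd _ _ (nbhs t0) (nbhs x0) _ [set y | `|x0 - y| < 1]).
  by apply: (@cvgr_dist_lt _ _ _ (nbhs x0) (nbhs_filter x0) id x0).
have h1 : `|radial_limit f x0 - radial_limit f z.2| < e / 2.
  near: z; apply: (@cvg_snd _ _ (nbhs t0) (nbhs x0) _
    [set y | `|radial_limit f x0 - radial_limit f y| < e / 2]).
  have /(@cvgrPdist_lt _ _ _ (nbhs x0) (nbhs_filter x0)) := @radial_limit_continuous f x0.
  exact.
have zd : z.1 < d.
  near: z.
  apply: (@cvg_fst _ _ (nbhs t0) (nbhs x0) _ [set t | t < d]).
  exact: lt_nbhsl (le_lt_trans t0_le0 d0).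
have -> : blowup f (t0, x0) = radial_limit f x0 by rewrite /blowup ltNge t0_le0.
rewrite /blowup; case: (ltP 0 z.1) => z0; last first.
  by rewrite (lt_trans h1)// ltr_pdivrMr// ltr_pMr// ltr1n.
have h2 := dP _ _ z0 zd xy.
move: h1 h2; rewrite !ltr_norml => /andP[? ?] /andP[? ?].
by apply/andP; split; lra.
Unshelve. all: by end_near. Qed.

End blowup.

(** * Density of lattice polynomials *)

(** Otherwise the complements in [K] of the sets satisfying [P] would generate a
    proper filter without cluster point in [K]. *)
Lemma compact_set_ind (T : topologicalType) (K : set T) (P : set T -> Prop) :
  compact K -> P set0 -> (forall U V, P U -> P V -> P (U `|` V)) ->
  (forall U V, U `<=` V -> P V -> P U) ->
  (forall z, K z -> exists2 U, nbhs z U & P U) -> P K.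
Proof.
move=> Kc P0 PU PS Ploc; apply: contrapT => nPK.
pose F := [set U | P (K `\` U)].
have FF : ProperFilter F.
  split; first by rewrite /F /= setD0.
  split=> [|U V FU FV|U V UV].
  - by rewrite /F /= setDT.
  - by rewrite /F /= setDIr; exact: PU.
  - by apply: PS; exact: setDS.
have FK : F K by rewrite /F /= setDv.
have [z [Kz zF]] := Kc F FF FK.
have [U zU UP] := Ploc _ Kz.
have FU : F (~` U) by rewrite /F /= setDE setCK; apply: PS UP; exact: subIsetr.
by have [y [nUy Uy]] := zF _ _ FU zU.
Qed.

(** Lattice form of the Stone-Weierstrass theorem: minima of interpolants at one
    fixed point and a second one stay below the function, up to [eps], on all of
    the compact set; maxima of these minima are also above it. *)
Lemma lattice_stone_weierstrass (R : realType) (T : topologicalType) (K : set T)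
    (L : set (T -> R)) (f : T -> R) :
  compact K -> continuous f -> (forall p, L p -> continuous p) ->
  (forall p q, L p -> L q -> L (fun z => Num.max (p z) (q z))) ->
  (forall p q, L p -> L q -> L (fun z => Num.min (p z) (q z))) ->
  (exists p, L p) ->
  (forall z w, K z -> K w -> exists p, [/\ L p, p z = f z & p w = f w]) ->
  forall eps : R, 0 < eps -> exists2 p, L p & forall z, K z -> `|f z - p z| < eps.
Proof.
move=> Kc cf cL Lmax Lmin L0 L2 eps eps0.
have below z : K z -> exists p, [/\ L p, p z = f z & forall w, K w -> p w < f w + eps].
  move=> Kz.
  pose P U := exists p, [/\ L p, p z = f z & forall w, U w -> p w < f w + eps].
  apply: (@compact_set_ind _ K P) => //.
  - by have [p [Lp pz _]] := L2 z z Kz Kz; exists p.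
  - move=> U V [p [Lp pz pU]] [q [Lq qz qV]].
    exists (fun z => Num.min (p z) (q z)); split; first exact: Lmin.
      by rewrite pz qz minxx.
    by move=> w [/pU|/qV] h; rewrite gt_min h ?orbT.
  - by move=> U V UV [p [Lp pz pV]]; exists p; split=> // w /UV/pV.
  - move=> w Kw; have [p [Lp pz pw]] := L2 z w Kz Kw.
    exists [set y | p y < f y + eps]; last by exists p.
    have pf : (p y - f y) @[y --> w] --> p w - f w.
      by apply: cvgB; [exact: cL|exact: cf].
    have : \forall y \near w, p y - f y < eps.
      by apply: (cvgr_lt (p w - f w)) => //; rewrite pw subrr.
    by apply: filterS => y /=; rewrite ltrBlDl addrC.
pose P U := exists p, [/\ L p, forall w, K w -> p w < f w + eps &
  forall w, U w -> f w - eps < p w].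
suff [p [Lp pK Kp]] : P K.
  exists p => // z Kz; rewrite ltr_norml.
  by have := pK _ Kz; have := Kp _ Kz; lra.
have [[z0 Kz0]|/forallNP K0] := pselect (exists z, K z); last first.
  by have [p Lp] := L0; exists p; split=> // w /K0.
apply: (@compact_set_ind _ K P) => //.
- by have [p [Lp pz pK]] := below _ Kz0; exists p.
- move=> U V [p [Lp pK pU]] [q [Lq qK qV]].
  exists (fun z => Num.max (p z) (q z)); split; first exact: Lmax.
    by move=> w Kw; rewrite gt_max pK ?qK.
  by move=> w [/pU|/qV] h; rewrite lt_max h ?orbT.
- by move=> U V UV [p [Lp pz pV]]; exists p; split=> // w /UV/pV.
- move=> w Kw; have [p [Lp pw pK]] := below w Kw.
  exists [set y | f y - eps < p y]; last by exists p.
  have pf : (p y - f y) @[y --> w] --> p w - f w.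
    by apply: cvgB; [exact: cL|exact: cf].
  have : \forall y \near w, - eps < p y - f y.
    by apply: (cvgr_gt (p w - f w)) => //; rewrite pw subrr oppr_lt0.
  by apply: filterS => y /=; lra.
Qed.

Record vector_sublattice (R : realType) (X : vectorLatticeType R) (Q : set X) :
    Prop := {
  sublattice0 : Q 0;
  sublattice_lin : forall (a : R) x y, Q x -> Q y -> Q (a *: x + y);
  sublattice_join : forall x y, Q x -> Q y -> Q (vjoin x y) }.

Section sublattices.
Variables (R : realType) (X : vectorLatticeType R) (Q : set X).
Hypothesis QL : vector_sublattice Q.

Lemma sublatticeZ (a : R) x : Q x -> Q (a *: x).
Proof.
move=> Qx; rewrite -[_ *: _]addr0; apply: sublattice_lin => //.
exact: sublattice0.
Qed.

Lemma sublatticeD x y : Q x -> Q y -> Q (x + y).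
Proof. by move=> Qx Qy; rewrite -[x]scale1r; exact: sublattice_lin. Qed.

Lemma sublatticeN x : Q x -> Q (- x).
Proof. by rewrite -scaleN1r; exact: sublatticeZ. Qed.

Lemma sublattice_meet x y : Q x -> Q y -> Q (vmeet x y).
Proof.
move=> Qx Qy; rewrite vmeetE; apply: sublatticeN.
by apply: (sublattice_join QL); exact: sublatticeN.
Qed.

End sublattices.

(** The power with exponent [k.+1]: there need not be an identity. *)
Definition apow (R : realType) (A : latticeAlgebraType R) (x : A) k : A :=
  iter k (amul x) x.

Definition abs_sum (R : realType) (X : vectorLatticeType R) n (x : 'I_n -> X) : X :=
  \sum_(i < n) vabs (x i).

Section density.
Variables (R : realType) (n : nat).
Implicit Types (f g : PGh R n) (x y : 'rV[R]_n) (t : R).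

Let s : PGh R n := abs_sum (fun i => PGh_coord R i).

Lemma PGh_leP f g : reflect (forall x, f x <= g x) (f <= g).
Proof. exact: PG_leP. Qed.

Lemma PGh_absE f x : vabs f x = `|f x|.
Proof. by rewrite -maxrN. Qed.

Lemma abs_sum_coordE x : s x = \sum_(i < n) `|x ord0 i|.
Proof.
rewrite /s /abs_sum (big_morph (fun f : PGh R n => f x) (id1 := 0) (op1 := +%R))//.
by apply: eq_bigr => i _; rewrite PGh_absE.
Qed.

Lemma apowE f k x : apow f k x = f x ^+ k.+1.
Proof.
elim: k => [|k IH]; first by rewrite expr1.
by rewrite exprS -IH.
Qed.

Lemma abs_sum_coordZ t x : 0 <= t -> s (t *: x) = t * s x.
Proof.
move=> t0; rewrite !abs_sum_coordE mulr_sumr; apply: eq_bigr => i _.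
by rewrite mxE normrM ger0_norm.
Qed.

Lemma blowup_abs_sum z : blowup s z = s z.2.
Proof.
have rq t x : 0 < t -> radial_quotient s t x = s x.
  move=> t0; rewrite /radial_quotient abs_sum_coordZ 1?ltW//.
  by rewrite mulrAC divff ?mul1r// gt_eqF.
rewrite /blowup; case: ltP => [z0|_]; first exact: rq.
apply: radial_limit_unique; apply: cvg_near_cst; near=> t.
by rewrite rq.
Unshelve. all: by end_near. Qed.

Lemma abs_sum_apow_ge0 k : 0 <= s + apow s k.
Proof.
apply/PGh_leP => x; rewrite [leRHS](_ : _ = s x + apow s k x)// apowE.
by rewrite addr_ge0 ?exprn_ge0// abs_sum_coordE sumr_ge0.
Qed.

(** Polar coordinates for the norm [s]: all nonzero points of the ball of radius
    [T] are of the form [t x] with [(t, x)] in this compact set. On it [s] has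
    blow-up 1 and [s * s] has blow-up [t]. *)
Definition polar_shell (T : R) : set (R * 'rV[R]_n) :=
  [set t | 0 <= t <= T] `*` [set x | s x = 1].

Lemma norm_le_abs_sum x : `|x| <= s x.
Proof.
rewrite [leLHS]/Num.norm /= mx_normrE; apply: bigmax_le => [|[i j] _ /=].
  by rewrite abs_sum_coordE sumr_ge0.
by rewrite (ord1 i) abs_sum_coordE (bigD1 j)//= lerDl sumr_ge0.
Qed.

Lemma compact_polar_shell T : compact (polar_shell T).
Proof.
apply: compact_setX.
  have -> : [set t | 0 <= t <= T] = `[0, T]%classic.
    by apply/seteqP; split=> t /=; rewrite in_itv.
  exact: segment_compact.
apply: bounded_closed_compact.
  exists 1; split; first exact: num_real.
  by move=> M M1 x /= x1; rewrite (le_trans (norm_le_abs_sum x))// x1 ltW.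
apply: (@closed_comp _ _ s [set (1 : R)]); last exact: closed_eq.
by move=> x _; exact: PGh_continuous.
Qed.

Lemma polar_decomposition x : x != 0 ->
  exists y, [/\ 0 < s x, s y = 1 & x = s x *: y].
Proof.
move=> x0; have sx : 0 < s x.
  by apply: lt_le_trans (norm_le_abs_sum x); rewrite normr_gt0.
exists ((s x)^-1 *: x); split=> //.
  by rewrite abs_sum_coordZ ?invr_ge0 1?ltW// mulVf// gt_eqF.
by rewrite scalerA divff ?scale1r// gt_eqF.
Qed.

(** In the unit ball the blow-up is bounded, by compactness of the polar shell;
    outside of it the polynomial growth applies. *)
Lemma PGh_growth f : exists (M : R) (N : nat), 0 <= M /\
  forall x, `|f x| <= M * (s x + s x ^+ N.+1).
Proof.
have /PG_predP[_ [N [M1 [N0 M10 fM1]]]] := valP (f : PG R n).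
have [M2 M20 fM2] : exists2 M : R, 0 <= M &
    forall z, polar_shell 1 z -> `|blowup f z| <= M.
  have /compact_bounded[b [_ bP]] : compact (blowup f @` polar_shell 1).
    apply: continuous_compact; last exact: compact_polar_shell.
    by apply: continuous_subspaceT; exact: blowup_continuous.
  exists (`|b| + 1); first exact: addr_ge0.
  move=> z Kz; apply: (bP (`|b| + 1)); last by exists z.
  by rewrite (le_lt_trans (ler_norm b))// ltrDl.
have s0 x : 0 <= s x by rewrite abs_sum_coordE sumr_ge0.
exists (M2 + M1 * 2 ^+ N), N.-1.
split; first by rewrite addr_ge0// mulr_ge0// exprn_ge0.
rewrite prednK// => x.
have [->|x0] := eqVneq x 0.
  by rewrite PGh_at0 normr0 mulr_ge0 ?addr_ge0 ?exprn_ge0// mulr_ge0// exprn_ge0.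
have c0 : 0 <= M1 * 2 ^+ N by rewrite mulr_ge0// exprn_ge0.
have [s1|s1] := leP (s x) 1.
  have [y [sx y1 xE]] := polar_decomposition x0.
  rewrite {1}xE blowupE// normrM (gtr0_norm sx) mulrC.
  apply: (@le_trans _ _ (M2 * s x)).
    by rewrite ler_wpM2r// fM2//; split=> //=; rewrite s0.
  by apply: ler_pM => //; rewrite ?lerDl ?exprn_ge0.
apply: le_trans (fM1 x) _; rewrite /growth_weight -abs_sum_coordE.
apply: (@le_trans _ _ (M1 * 2 ^+ N * s x ^+ N)).
  rewrite -mulrA -exprMn ler_wpM2l// lerXn2r ?nnegrE ?addr_ge0 ?mulr_ge0//.
  by rewrite mulr2n mulrDl mul1r lerD2r ltW.
by apply: ler_pM; rewrite ?exprn_ge0 ?lerDr.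
Qed.

(** On a large ball this is the lattice Stone-Weierstrass theorem for the
    blow-ups, whose values at two points of the polar shell are interpolated by
    combinations of [s] with [s * s] or with a coordinate. Truncating the
    approximant by a bound of [f] of lower degree than the weight makes it
    harmless outside of the ball. Finitely many powers of [s] suffice for all
    [eps]; without this the approximants could not be compared on one ideal. *)
Theorem PGh_dense f : exists N : nat, forall Q : set (PGh R n),
  vector_sublattice Q -> (forall i, Q (PGh_coord R i)) ->
  (forall k, (k <= N)%N -> Q (apow s k)) ->
  forall eps : R, 0 < eps -> exists2 g, Q g & vabs (f - g) <= eps *: (s + apow s N).
Proof.
have [M [N [M0 fM]]] := PGh_growth f; exists N.+1 => Q QL Qcoord Qpow eps eps0.
have Qs : Q s by exact: (Qpow 0%N).
have s0 x : 0 <= s x by rewrite abs_sum_coordE sumr_ge0.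
(* Beyond [T] the weight times [eps] exceeds twice the bound [B] of [f] below. *)
pose T := 1 + 4 * M / eps.
pose L := [set blowup q | q in (Q : set (PGh R n))].
have interp z w : polar_shell T z -> polar_shell T w ->
    exists p, [/\ L p, p z = blowup f z & p w = blowup f w].
  move=> [/= z1 z2] [/= w1 w2].
  have sep (h : PGh R n) : Q h -> blowup h z != blowup h w ->
      exists p, [/\ L p, p z = blowup f z & p w = blowup f w].
    move=> Qh hzw; have hzw' : blowup h z - blowup h w != 0 by rewrite subr_eq0.
    pose b := (blowup f z - blowup f w) / (blowup h z - blowup h w).
    pose a := blowup f z - b * blowup h z.
    have QL' := sublattice_lin QL a Qs (sublatticeZ QL b Qh).
    exists (blowup (a *: s + b *: h : PGh R n)).
    split; first by exists (a *: s + b *: h).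
      rewrite blowup_lin -[b *: h]addr0 blowup_lin blowup_abs_sum z2 blowup0.
      by rewrite /a; ring.
    rewrite blowup_lin -[b *: h]addr0 blowup_lin blowup_abs_sum w2 blowup0.
    by rewrite /a /b; field.
  have [zw|zw] := eqVneq z w.
    have fzE : blowup (blowup f z *: s + 0 : PGh R n) z = blowup f z.
      by rewrite blowup_lin blowup0 blowup_abs_sum z2 mulr1 addr0.
    exists (blowup (blowup f z *: s + 0 : PGh R n)); rewrite -zw fzE; split=> //.
    exists (blowup f z *: s + 0) => //.
    exact: (sublattice_lin QL _ Qs (sublattice0 QL)).
  have [zw1|zw1] := eqVneq z.1 w.1; last first.
    apply: (sep (apow s 1)); first exact: Qpow.
    case: z w z1 z2 w1 w2 zw1 {sep zw} => [t x] [u y] /=.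
    move=> /andP[t0 _] x1 /andP[u0 _] y1 tu.
    by rewrite /apow /= !blowup_mul// !blowup_abs_sum x1 y1 !mulr1.
  have /eqP/rowP/existsNP[i zwi] : z.2 != w.2.
    apply: contra zw => /eqP zw2.
    by rewrite [z]surjective_pairing zw1 zw2 -surjective_pairing.
  apply: (sep (PGh_coord R i)) => //.
  by rewrite !blowup_coord; exact/eqP.
have [|p q [p' Qp <-] [q' Qq <-]|p q [p' Qp <-] [q' Qq <-]||_ [q Qq <-] fq] :=
  @lattice_stone_weierstrass _ _ _ L _ (@compact_polar_shell T)
    (@blowup_continuous _ _ f) _ _ _ _ interp eps eps0.
- by move=> _ [q _ <-]; exact: blowup_continuous.
- exists (vjoin p' q'); first exact: sublattice_join.
  by apply/funext => z; exact: blowup_max.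
- exists (vmeet p' q'); first exact: sublattice_meet.
  by apply/funext => z; exact: blowup_min.
- by exists (blowup s), s.
pose B := M *: (s + apow s N).
have QB : Q B by apply: sublatticeZ => //; apply: sublatticeD => //; apply: Qpow.
have BE x : B x = M * (s x + s x ^+ N.+1) by rewrite -apowE.
have clip (a b c : R) : `|a| <= b ->
    `|a - Num.max (- b) (Num.min c b)| <= Num.min `|a - c| (b + b).
  rewrite ler_norml => /andP[ab1 ab2].
  have h1 := ler_norm (a - c).
  have h2 := ler_norm (- (a - c)); rewrite normrN in h2.
  rewrite le_min; case: (leP c b) => cb.
    by case: (leP (- b) c) => bc; rewrite !ler_norml; apply/andP; split; lra.
  by case: (leP (- b) b) => bb; rewrite !ler_norml; apply/andP; split; lra.
exists (vjoin (- B) (vmeet q B)).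
  by apply: sublattice_join => //; [exact: sublatticeN|exact: sublattice_meet].
apply/PGh_leP => x; rewrite PGh_absE.
have -> : (eps *: (s + apow s N.+1) : PGh R n) x = eps * (s x + s x ^+ N.+2).
  by rewrite -apowE.
have := clip (f x) (B x) (q x); rewrite {1}BE => /(_ (fM x)).
rewrite le_min => /andP[fq1 fq2].
have [x0|x0] := eqVneq x 0.
  apply: le_trans fq1 _; rewrite x0 !PGh_at0 subrr normr0.
  by rewrite mulr_ge0 ?addr_ge0 ?exprn_ge0 ?s0// ltW.
have [sT|sT] := leP (s x) T.
  apply: le_trans fq1 _; have [y [sx y1 xE]] := polar_decomposition x0.
  rewrite {1 2}xE !blowupE// -mulrBr normrM (gtr0_norm sx) mulrC.
  apply: ler_pM => //; last by rewrite lerDl exprn_ge0.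
  by apply/ltW/fq; split=> //=; rewrite s0.
apply: le_trans fq2 _; rewrite BE.
have T1 : 1 <= T by rewrite lerDl divr_ge0 ?mulr_ge0// ltW.
have sx1 : 1 <= s x by exact: le_trans T1 (ltW sT).
have sN : s x <= s x ^+ N.+1 by rewrite -[leLHS]expr1 ler_weXn2l.
have : 4 * M <= eps * s x.
  rewrite -ler_pdivrMl// mulrC; apply: le_trans (ltW sT).
  by rewrite lerDr.
move=> /(ler_wpM2r (exprn_ge0 N.+1 (s0 x))).
rewrite -mulrA -[in leRHS]mulrA -exprS => h.
apply: (@le_trans _ _ (4 * (M * s x ^+ N.+1))); last first.
  by apply: le_trans h _; rewrite ler_wpM2l ?lerDr// ltW.
have := ler_wpM2l M0 sN; rewrite !mulrDr; lra.
Qed.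

End density.

(** * Function algebras are uniformly complete f-algebras *)

Section function_algebras.
Variables (R : realType) (n : nat).

Lemma min_scale_eq0 (a b c : R) : Num.min a b = 0 -> 0 <= c -> Num.min (c * a) b = 0.
Proof.
case: (leP a b) => ab m0 c0; first by rewrite m0 mulr0 min_l// -m0.
by rewrite m0 min_r// mulr_ge0// -m0 ltW.
Qed.

Lemma PG_f_algebra : f_algebra (PG R n).
Proof.
move=> x y z xy z0; have xyp p : Num.min (x p) (y p) = 0.
  by have /(congr1 (fun f : PG R n => f p)) := xy.
have zp p : 0 <= z p by move/PG_leP : z0; exact.
by split; apply: PG_ext => p; rewrite /= ?[x p * z p]mulrC; exact: min_scale_eq0.
Qed.

Lemma PGh_f_algebra : f_algebra (PGh R n).
Proof.
move=> x y z xy z0; have [h1 h2] := @PG_f_algebra x y z (congr1 val xy) z0.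
by split; exact: val_inj.
Qed.

Lemma PG_archimedean : vl_archimedean (PG R n).
Proof.
move=> x y x0 xy; apply: PG_ext => p.
have xkE k : (x *+ k) p = x p *+ k.
  by elim: k => [|k IH]; rewrite ?mulr0n// !mulrS -IH.
have xp0 : 0 <= x p by move/PG_leP : x0; exact.
apply/le_anti; rewrite xp0 andbT leNgt; apply/negP => xp.
have yxp : 0 <= y p / x p.
  by rewrite divr_ge0//; have /PG_leP := xy 0%N; exact.
have := archi_boundP yxp; rewrite ltr_pdivrMr// ltNge mulr_natl -xkE.
by move=> /negP; apply; have /PG_leP := xy (Num.bound (y p / x p)); exact.
Qed.

Lemma PGh_archimedean : vl_archimedean (PGh R n).
Proof.
move=> x y x0 xy; apply: val_inj; apply: (@PG_archimedean _ y) => // k.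
have <- : val (x *+ k) = val x *+ k.
  by elim: k => [|k IH]; rewrite ?mulr0n// !mulrS -IH.
exact: xy.
Qed.

Lemma pointwise_ru_limit (T : Type) (u : nat -> T -> R) (e : T -> R) :
  (forall eps : R, 0 < eps -> exists N : nat, forall p q, (N <= p)%N -> (N <= q)%N ->
    forall x, `|u p x - u q x| <= eps * e x) ->
  exists l, forall eps : R, 0 < eps -> exists N : nat, forall p, (N <= p)%N ->
    forall x, `|u p x - l x| <= eps * e x.
Proof.
move=> uC.
have e0 x : 0 <= e x.
  have [N /(_ N N (leqnn _) (leqnn _) x)] := uC 1 ltr01.
  by rewrite mul1r; exact: le_trans.
have ul x : cvg (u k x @[k --> \oo]).
  apply: cauchy_cvg; apply: cauchy_exP => eps eps0.
  have d0 : 0 < eps / (e x + 1) by rewrite divr_gt0// ltr_wpDl.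
  have [N uN] := uC _ d0; exists (u N x); exists N => // k /= Nk.
  apply: le_lt_trans (uN N k _ _ x) _ => //.
  by rewrite mulrAC ltr_pdivrMr ?ltr_wpDl// ltr_pM2l// ltrDl.
exists (fun x => lim (u k x @[k --> \oo])) => eps eps0.
have [N uN] := uC _ eps0; exists N => p Np x.
apply/ler_addgt0Pl => d d0.
have /cvgrPdist_lt/(_ _ d0)[M _ uM] := ul x.
have /= h1 := uM (maxn N M) (leq_maxr N M).
have h2 := uN p (maxn N M) Np (leq_maxl N M) x.
rewrite (le_trans (ler_distD (u (maxn N M) x) _ _))// addrC lerD// distrC.
exact: ltW.
Qed.

Lemma PG_absE (f : PG R n) x : vabs f x = `|f x|.
Proof. by rewrite -maxrN. Qed.

(** The weight [e] is locally bounded, hence the pointwise limit is locally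
    uniform. *)
Lemma PG_ru_complete (e : PG R n) u : 0 <= e -> ru_cauchy e u ->
  exists l, ru_cvg e u l.
Proof.
move=> e0 uC.
have [|l ul] := @pointwise_ru_limit _ (fun k x => u k x) e.
  move=> eps /uC[N uN]; exists N => p q Np Nq x.
  by have /PG_leP/(_ x) := uN p q Np Nq; rewrite PG_absE.
have ep x : 0 <= e x by move/PG_leP : e0; exact.
have cPG (f : PG R n) : continuous f by have /PG_predP[] := valP f.
have lPG : l \in @PG_pred R n.
  have [N uN] := ul 1 ltr01.
  apply: (PG_predW (valP e) (valP (u N))) => [|x]; last first.
    have := uN N (leqnn _) x; rewrite mul1r => h.
    rewrite -(subKr (u N x) (l x)); apply: le_trans (ler_normB _ _) _.
    by rewrite addrC lerD// (le_trans h)// ler_norm.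
  suff lc (x : 'rV[R]_n) : l y @[y --> x] --> l x by move=> x; exact: lc.
  apply/(@cvgrPdist_lt _ _ _ (nbhs x) (nbhs_filter x)) => r r0.
  have ex1 : 0 < e x + 1 by rewrite ltr_wpDl.
  have d0 : 0 < r / 4 / (e x + 1) by rewrite !divr_gt0.
  have [M uM] := ul _ d0.
  have de : r / 4 / (e x + 1) * (e x + 1) = r / 4 by rewrite divfK// gt_eqF.
  near=> y.
  have ey : e y < e x + 1.
    near: y; apply: (cvgr_lt (e x)); first exact: cPG.
    by rewrite ltrDl.
  have uy : `|u M x - u M y| < r / 4.
    near: y.
    have /(@cvgrPdist_lt _ _ _ (nbhs x) (nbhs_filter x)) := @cPG (u M) x.
    by apply; rewrite divr_gt0.
  have h1 : `|u M x - l x| <= r / 4.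
    by rewrite -de (le_trans (uM M (leqnn _) x))// ler_wpM2l ?lerDl// ltW.
  have h2 := le_trans (uM M (leqnn _) y) (ler_wpM2l (ltW d0) (ltW ey)).
  move: h1 h2 uy; rewrite de ltr_norml !ler_norml ltr_norml; lra.
exists (MkPG lPG) => eps eps0; have [N uN] := ul _ eps0.
by exists N => p Np; apply/PG_leP => x; rewrite PG_absE; exact: uN.
Unshelve. all: by end_near. Qed.

(** The radial derivatives converge as well, with weight the radial derivative of
    [e], which is bounded on bounded sets. *)
Lemma PGh_ru_complete (e : PGh R n) u : 0 <= e -> ru_cauchy e u ->
  exists l, ru_cvg e u l.
Proof.
move=> e0 uC.
have [l ul] := @PG_ru_complete e (fun k => u k) e0 uC.
have [|g ug] := @pointwise_ru_limit _ (fun k => radial_limit (u k)) (radial_limit e).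
  move=> eps /uC[N uN]; exists N => p q Np Nq x.
  by have := blowup_dist (0, x) (uN p q Np Nq); rewrite /blowup ltxx.
have lP : l \in @PGh_pred R n.
  apply/PGh_predP; exists g => B bB eps eps0.
  have [K eK] := radial_cvg_bounded (@radial_limit_uniform _ _ e) bB.
  have K1 : 0 < 2 * `|K| + 2 by rewrite ltr_wpDl// mulr_ge0.
  have d0 : 0 < eps / 2 / (2 * `|K| + 2) by rewrite !divr_gt0.
  have [N1 uN1] := ul _ d0; have [N2 uN2] := ug _ d0.
  pose N := maxn N1 N2; set d := eps / 2 / (2 * `|K| + 2) in d0 uN1 uN2.
  have dE : d * (2 * `|K| + 2) = eps / 2 by rewrite divfK// gt_eqF.
  have e2 : 0 < eps / 2 by rewrite divr_gt0.
  near=> t.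
  have t0 : 0 < t by [].
  have h1 y : B y -> `|radial_quotient (u N) t y - radial_limit (u N) y| < eps / 2.
    by move: y; near: t; exact: radial_limit_uniform.
  have h2 y : B y -> `|radial_quotient e t y - radial_limit e y| < 1.
    by move: y; near: t; exact: radial_limit_uniform.
  move=> x Bx; move: h1 h2 => /(_ _ Bx) h1 /(_ _ Bx) h2.
  have h3 : `|radial_quotient (u N) t x - radial_quotient l t x| <=
      d * radial_quotient e t x.
    rewrite /radial_quotient -mulrBl normrM [`|t^-1|]gtr0_norm ?invr_gt0// mulrA.
    rewrite ler_pM2r ?invr_gt0//.
    by have /PG_leP/(_ (t *: x)) := uN1 N (leq_maxl _ _); rewrite PG_absE.
  have h4 := uN2 N (leq_maxr _ _) x.
  have h5 := eK _ Bx; have h6 := ler_norm K.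
  have h7 : d * (radial_quotient e t x + radial_limit e x) <= d * (2 * `|K| + 1).
    rewrite ler_wpM2l ?(ltW d0)//; move: h2 h5; rewrite ltr_norml ler_norml; lra.
  by move: h1 h3 h4 h7 dE; rewrite !ltr_norml !ler_norml; lra.
exists (MkPGh lP) => eps eps0; have [N uN] := ul _ eps0.
by exists N => p Np; exact: uN.
Unshelve. all: by end_near. Qed.

Lemma PG_uniformly_complete : uniformly_complete (PG R n).
Proof. by split; [exact: PG_archimedean|apply/ru_completeP; exact: PG_ru_complete]. Qed.

Lemma PGh_uniformly_complete : uniformly_complete (PGh R n).
Proof.
by split; [exact: PGh_archimedean|apply/ru_completeP; exact: PGh_ru_complete].
Qed.

End function_algebras.

(** * The free uniformly complete f-algebra *)

Lemma vsum_ge0 (R : realType) (X : vectorLatticeType R) (I : Type) (r : seq I)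
    (P : pred I) (F : I -> X) :
  (forall i, P i -> 0 <= F i) -> 0 <= \sum_(i <- r | P i) F i.
Proof.
by move=> F0; apply: (big_ind (fun x => 0 <= x)) => // x y; exact: vaddr_ge0.
Qed.

Section homomorphisms.
Variables (R : realType) (A B : latticeAlgebraType R) (h : A -> B).
Hypothesis hh : lattice_algebra_hom h.

Lemma hom_lin (a : R) x y : h (a *: x + y) = a *: h x + h y.
Proof. by have [hl _ _ _] := hh; exact: hl. Qed.

Lemma homB x y : h (x - y) = h x - h y.
Proof. by rewrite -scaleN1r addrC hom_lin scaleN1r addrC. Qed.

Lemma hom0 : h 0 = 0.
Proof. by have := homB 0 0; rewrite !subrr. Qed.

Lemma homZ (a : R) x : h (a *: x) = a *: h x.
Proof. by rewrite -[a *: x]addr0 hom_lin hom0 addr0. Qed.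

Lemma homD x y : h (x + y) = h x + h y.
Proof. by rewrite -[x]scale1r hom_lin !scale1r. Qed.

Lemma hom_join x y : h (vjoin x y) = vjoin (h x) (h y).
Proof. by have [_ _ hj _] := hh; exact: hj. Qed.

Lemma hom_mul x y : h (amul x y) = amul (h x) (h y).
Proof. by have [_ _ _ hm] := hh; exact: hm. Qed.

Lemma hom_abs x : h (vabs x) = vabs (h x).
Proof. by rewrite /vabs hom_join -[- x]sub0r homB hom0 sub0r. Qed.

Lemma hom_le x y : x <= y -> h x <= h y.
Proof. by move=> /vjoin_r <-; rewrite hom_join vjoin_ubl. Qed.

Lemma hom_apow x k : h (apow x k) = apow (h x) k.
Proof. by elim: k => [//|k IH]; rewrite /apow /= hom_mul -/(apow x k) IH. Qed.

Lemma hom_abs_sum n (x : 'I_n -> A) : h (abs_sum x) = abs_sum (h \o x).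
Proof.
rewrite /abs_sum (big_morph h homD hom0); apply: eq_bigr => i _.
exact: hom_abs.
Qed.

End homomorphisms.

Section free_object.
Variables (R : realType) (n : nat) (A : latticeAlgebraType R).
Hypotheses (fA : f_algebra A) (uA : uniformly_complete A).
Implicit Types (f g : PGh R n) (y z E F : A).

Let s : PGh R n := abs_sum (fun i => PGh_coord R i).

(** The functions at which two homomorphisms agree form a sublattice, to which the
    density theorem applies, and homomorphisms are continuous for relatively
    uniform convergence. *)
Lemma PGh_hom_ext (h k : PGh R n -> A) :
  lattice_algebra_hom h -> lattice_algebra_hom k ->
  (forall i, h (PGh_coord R i) = k (PGh_coord R i)) -> h = k.
Proof.
move=> hh kh hk; apply/funext => f; have [N fN] := PGh_dense f.
have hs : h s = k s.
  by rewrite !hom_abs_sum//; congr abs_sum; apply/funext => i; exact: hk.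
have [uarch _] := uA.
have hpow j : h (apow s j) = k (apow s j) by rewrite !hom_apow// hs.
pose W := s + apow s N.
have hW : h W = k W by rewrite !homD// hs hpow.
have W0 : 0 <= h W.
  by rewrite -(hom0 hh); apply: hom_le => //; exact: abs_sum_apow_ge0.
apply/eqP; rewrite -subr_eq0; apply/eqP; apply: (arch_eq0 uarch W0) => eps eps0.
have e2 : 0 < eps / 2 by rewrite divr_gt0.
have [|i|j _|g gQ fg] := fN [set g | h g = k g] _ _ _ _ e2.
- split=> [|a x y /= xQ yQ|x y /= xQ yQ] /=.
  + by rewrite !hom0.
  + by rewrite !hom_lin// xQ yQ.
  + by rewrite !hom_join// xQ yQ.
- exact: hk.
- exact: hpow.
have fgE (j : PGh R n -> A) : lattice_algebra_hom j ->
    vabs (j f - j g) <= (eps / 2) *: j W.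
  by move=> jh; rewrite -homB// -hom_abs// -homZ// hom_le.
rewrite (le_trans (vabs_tri (h g) _ _))// [eps]splitr scalerDl vlerD ?fgE//.
by rewrite gQ vabsB hW fgE.
Qed.

Variable a : 'I_n -> A.

(** The relation [y = f(a)], tested on the characters of the ideal of [E]: to a
    character [phi] of scale [t], the elements of the algebra generated by [a]
    look like the values of blow-ups at the point [(t, phi a)]. The level [E] is
    explicit because a character of an ideal need not extend to a larger one. *)
Definition evaluates E f y := dominated E y /\
  forall phi t, character E phi t -> phi y = blowup f (t, \row_i phi (a i)).

Lemma evaluatesW E F f y : E <= F -> evaluates E f y -> evaluates F f y.
Proof.
move=> EF [yE fy]; split; first exact: dominatedW yE.
by move=> phi t /(characterW EF)/fy.
Qed.

Lemma evaluates0 E : 0 <= E -> evaluates E 0 0.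
Proof.
move=> E0; split; first exact: dominated0.
by move=> phi t [phiE _ _]; rewrite blowup0 (functional0 phiE).
Qed.

Lemma evaluates_lin E (c : R) f g y z : evaluates E f y -> evaluates E g z ->
  evaluates E (c *: f + g) (c *: y + z).
Proof.
move=> [yE fy] [zE gz]; split; first by apply: dominatedD => //; exact: dominatedZ.
move=> phi t phiP; have [phiE _ _] := phiP.
by rewrite (functional_lin phiE)// blowup_lin (fy _ _ phiP) (gz _ _ phiP).
Qed.

Lemma evaluatesD E f g y z : evaluates E f y -> evaluates E g z ->
  evaluates E (f + g) (y + z).
Proof. by move=> fy gz; rewrite -[f]scale1r -[y]scale1r; exact: evaluates_lin. Qed.

Lemma evaluatesB E f g y z : evaluates E f y -> evaluates E g z ->
  evaluates E (f - g) (y - z).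
Proof.
move=> fy gz; rewrite [f - g]addrC [y - z]addrC -(scaleN1r g) -(scaleN1r z).
exact: evaluates_lin.
Qed.

Lemma evaluatesZ E (c : R) f y : 0 <= E -> evaluates E f y ->
  evaluates E (c *: f) (c *: y).
Proof.
move=> E0 fy; rewrite -[c *: f]addr0 -[c *: y]addr0.
by apply: evaluates_lin (evaluates0 E0).
Qed.

Lemma evaluates_join E f g y z : evaluates E f y -> evaluates E g z ->
  evaluates E (vjoin f g) (vjoin y z).
Proof.
move=> [yE fy] [zE gz]; split; first exact: dominated_vjoin.
move=> phi t phiP; have [phiE _ _] := phiP.
by rewrite (functional_join phiE)// blowup_max (fy _ _ phiP) (gz _ _ phiP).
Qed.

Lemma evaluates_abs E f y : 0 <= E -> evaluates E f y -> evaluates E (vabs f) (vabs y).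
Proof.
move=> E0 fy; apply: evaluates_join => //.
by rewrite -[- f]sub0r -[- y]sub0r; apply: evaluatesB => //; exact: evaluates0.
Qed.

(** The level increases, since the product leaves the ideal of [E]. *)
Lemma evaluates_mul E f g y z : 0 <= E -> evaluates E f y -> evaluates E g z ->
  evaluates (E + amul E E) (amul f g) (amul y z).
Proof.
move=> E0 [yE fy] [zE gz]; have EE0 : 0 <= amul E E by exact: amul_ge0.
split; first by apply: dominatedW (dominated_amul E0 E0 yE zE); rewrite vlerDr.
have EF : E <= E + amul E E by rewrite vlerDl.
move=> phi t /(characterW EF) phiP; have [phiE t0 phiM] := phiP.
by rewrite phiM// blowup_mul// (fy _ _ phiP) (gz _ _ phiP).
Qed.

Lemma evaluates_coord E i : dominated E (a i) -> evaluates E (PGh_coord R i) (a i).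
Proof. by move=> aE; split=> // phi t _; rewrite blowup_coord mxE. Qed.

(** Characters separate points, and blow-ups of nonnegative functions are
    nonnegative. *)
Lemma evaluates_ge0 E f y : 0 <= E -> evaluates E f y -> 0 <= f -> 0 <= y.
Proof.
move=> E0 [yE fy] f0; apply: contrapT => y0; have [uarch _] := uA.
have [phi [t [phiP]]] := exists_character fA uarch E0 yE y0.
by rewrite (fy _ _ phiP) ltNge blowup_ge0.
Qed.

Lemma evaluates_le E f g y z : 0 <= E -> evaluates E f y -> evaluates E g z ->
  f <= g -> y <= z.
Proof.
move=> E0 fy gz fg; rewrite -vsubr_ge0; apply: (evaluates_ge0 E0 (evaluatesB gz fy)).
by rewrite vsubr_ge0.
Qed.

Lemma evaluates_unique E F f y z : 0 <= E -> 0 <= F ->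
  evaluates E f y -> evaluates F f z -> y = z.
Proof.
move=> E0 F0 fy fz; have EF0 := vaddr_ge0 E0 F0.
have {}fy : evaluates (E + F) f y by apply: evaluatesW fy; rewrite vlerDl.
have {}fz : evaluates (E + F) f z by apply: evaluatesW fz; rewrite vlerDr.
by apply/le_anti; rewrite (evaluates_le EF0 fy fz)// (evaluates_le EF0 fz fy).
Qed.

Lemma evaluates_abs_sum E : 0 <= E -> (forall i, dominated E (a i)) ->
  evaluates E s (abs_sum a).
Proof.
move=> E0 aE; rewrite /s /abs_sum.
elim/big_ind2: _ => [|f y g z|i _]; [exact: evaluates0|exact: evaluatesD|].
by apply: evaluates_abs => //; exact: evaluates_coord.
Qed.

Lemma evaluates_apow N : exists2 E, 0 <= E & (forall i, dominated E (a i)) /\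
  forall k, (k <= N)%N -> evaluates E (apow s k) (apow (abs_sum a) k).
Proof.
elim: N => [|N [E E0 [aE sE]]].
  have e0 : 0 <= abs_sum a by apply: vsum_ge0 => i _; exact: vabs_ge0.
  have ae i : dominated (abs_sum a) (a i).
    exists 1 => //; rewrite scale1r /abs_sum (bigD1 i)//= vlerDl.
    by apply: vsum_ge0 => j _; exact: vabs_ge0.
  exists (abs_sum a) => //; split=> // k; rewrite leqn0 => /eqP ->.
  exact: evaluates_abs_sum.
have EE0 : 0 <= amul E E by exact: amul_ge0.
have EF : E <= E + amul E E by rewrite vlerDl.
exists (E + amul E E); first exact: le_trans EF.
split=> [i|k]; first exact: dominatedW (aE i).
rewrite leq_eqVlt => /predU1P[->|]; last by rewrite ltnS => /sE; exact: evaluatesW.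
by apply: evaluates_mul => //; [exact: (sE 0%N)|exact: sE].
Qed.

(** All approximants of [f] given by the density theorem have values at one level
    [E]. By positivity these values form a Cauchy sequence, whose limit is the
    value of [f] since characters of the ideal of [E] are continuous. *)
Lemma evaluates_total f : exists E y, 0 <= E /\ evaluates E f y.
Proof.
have [N fN] := PGh_dense f; have [E E0 [aE powE]] := evaluates_apow N.
have [_ /ru_completeP ucA] := uA.
have {}fN eps : 0 < eps -> exists gz : PGh R n * A, evaluates E gz.1 gz.2 /\
    vabs (f - gz.1) <= eps *: (s + apow s N).
  have QL : vector_sublattice [set g | exists z, evaluates E g z].
    split=> [|c g k [y gy] [z kz]|g k [y gy] [z kz]].
    - by exists 0; exact: evaluates0.
    - by exists (c *: y + z); exact: evaluates_lin.
    - by exists (vjoin y z); exact: evaluates_join.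
  move=> eps0; have [i|k kN|g [z gz] fg] := fN _ QL _ _ _ eps0.
  - by exists (a i); exact: evaluates_coord.
  - by exists (apow (abs_sum a) k); exact: powE.
  - by exists (g, z).
have inv0 k : 0 < (k.+1%:R : R)^-1 by rewrite invr_gt0 ltr0n.
have /choice[u uP] := fun k => fN _ (inv0 k).
pose W := s + apow s N; pose w := abs_sum a + apow (abs_sum a) N.
have Ww : evaluates E W w by apply: evaluatesD; [exact: (powE 0%N)|exact: powE].
have W0 : 0 <= W by exact: abs_sum_apow_ge0.
have w0 : 0 <= w by exact: evaluates_ge0 Ww W0.
have small eps : 0 < eps -> exists M : nat, forall k, (M <= k)%N ->
    vabs (f - (u k).1) <= eps *: W.
  move=> eps0; exists (Num.bound eps^-1) => k Mk.
  have [_ /le_trans] := uP k; apply; apply: vlerZr => //.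
  rewrite -[leRHS]invrK lef_pV2 ?posrE ?invr_gt0 ?ltr0n//.
  apply: ltW; apply: lt_le_trans (archi_boundP _) _; first by rewrite invr_ge0 ltW.
  by rewrite ler_nat ltnW.
have [|y uy] := ucA w (fun k => (u k).2) w0.
  move=> eps eps0; have e2 : 0 < eps / 2 by rewrite divr_gt0.
  have [M uM] := small _ e2; exists M => p q Mp Mq.
  have [up _] := uP p; have [uq _] := uP q.
  apply: (evaluates_le E0 (evaluates_abs E0 (evaluatesB up uq)) (evaluatesZ eps E0 Ww)).
  rewrite (le_trans (vabs_tri f _ _))// [eps]splitr scalerDl vlerD ?uM//.
  by rewrite vabsB uM.
have [wE Wphi] := Ww.
have yE k : dominated w ((u k).2 - y) -> dominated E y.
  move=> [l l0 uyl]; rewrite -(subKr (u k).2 y); apply: dominatedB.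
    by have [[]] := uP k.
  apply: dominated_le (dominatedZ l wE).
  by rewrite [vabs (l *: w)]vabs_id// vscale_ge0.
exists E, y; split=> //; split.
  have [M uM] := uy 1 ltr01; apply: (yE M).
  by exists 1 => //; exact: uM.
move=> phi t phiP; have [phiE t0 _] := phiP.
set x := \row_i _.
have phiw : 0 <= phi w by apply: (functional_ge0 phiE).
apply/eqP; rewrite -subr_eq0 -normr_le0.
apply/ler_addgt0Pl => d d0; rewrite addr0.
have w1 : 0 < phi w + phi w + 1 by rewrite ltr_wpDl// addr_ge0.
have e0 : 0 < d / (phi w + phi w + 1) by rewrite divr_gt0.
have [M1 uM1] := small _ e0; have [M2 uM2] := uy _ e0.
pose k := maxn M1 M2.
have [[ukE /(_ _ _ phiP) ukphi] _] := uP k.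
have yE' := yE M2 _; have {yE'}yE' : dominated E y.
  apply: (yE M2); exists (d / (phi w + phi w + 1)); first exact: ltW.
  exact: uM2.
have h1 : `|phi (u k).2 - phi y| <= d / (phi w + phi w + 1) * phi w.
  rewrite -(functionalB phiE)// -(functionalZ phiE)//.
  apply: (functional_abs_le phiE); [exact: E0|exact: dominatedB|exact: dominatedZ|].
  exact: uM2 (leq_maxr _ _).
have h2 : `|blowup f (t, x) - phi (u k).2| <= d / (phi w + phi w + 1) * phi w.
  rewrite ukphi [X in _ <= _ * X](Wphi _ _ phiP); apply: blowup_dist.
  exact: uM1 (leq_maxl _ _).
have h3 : `|phi y - blowup f (t, x)| <=
    d / (phi w + phi w + 1) * phi w + d / (phi w + phi w + 1) * phi w.
  rewrite distrC; apply: le_trans (ler_distD (phi (u k).2) _ _) _.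
  exact: lerD h2 h1.
apply: le_trans h3 _; rewrite -mulrDr mulrAC ler_pdivrMr//.
by apply: ler_wpM2l; [exact: ltW|rewrite lerDl].
Qed.

Definition eval_at f : A := projT1 (cid (projT2 (cid (evaluates_total f)))).

Lemma eval_atP f : exists2 E, 0 <= E & evaluates E f (eval_at f).
Proof.
rewrite /eval_at; case: cid => E fE; case: cid => y [E0 fy].
by exists E.
Qed.

Lemma eval_at_eq E f y : 0 <= E -> evaluates E f y -> eval_at f = y.
Proof.
by move=> E0 fy; have [F F0 fz] := eval_atP f; exact: evaluates_unique fz fy.
Qed.

Lemma eval_at2 f g : exists E, [/\ 0 <= E, evaluates E f (eval_at f) &
  evaluates E g (eval_at g)].
Proof.
have [E E0 fE] := eval_atP f; have [F F0 gF] := eval_atP g.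
exists (E + F); split; first exact: vaddr_ge0.
- by apply: evaluatesW fE; rewrite vlerDl.
- by apply: evaluatesW gF; rewrite vlerDr.
Qed.

Lemma eval_at_hom : lattice_algebra_hom eval_at.
Proof.
split=> [c f g|f g|f g|f g]; have [E [E0 fE gE]] := eval_at2 f g.
- by apply: (eval_at_eq E0); exact: evaluates_lin.
- apply: (eval_at_eq E0); rewrite !vmeetE.
  have evN h : evaluates E h (eval_at h) -> evaluates E (- h) (- eval_at h).
    by move=> hE; rewrite -(scaleN1r h) -(scaleN1r (eval_at h)); exact: evaluatesZ.
  rewrite -[X in evaluates _ X]sub0r -[X in evaluates _ _ X]sub0r.
  by apply: evaluatesB; [exact: evaluates0|apply: evaluates_join; exact: evN].
- by apply: (eval_at_eq E0); exact: evaluates_join.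
- apply: eval_at_eq (evaluates_mul E0 fE gE).
  by apply: vaddr_ge0 => //; exact: amul_ge0.
Qed.

Lemma eval_at_coord i : eval_at (PGh_coord R i) = a i.
Proof.
apply: (eval_at_eq (vabs_ge0 (a i))); apply: evaluates_coord.
by exists 1 => //; rewrite scale1r.
Qed.

End free_object.

Theorem PGh_free (R : realType) n : free_uc_falgebra (fun i : 'I_n => PGh_coord R i).
Proof.
split; [exact: PGh_f_algebra|exact: PGh_uniformly_complete|].
move=> A fA uA a; exists (eval_at fA uA a); split.
  split; first exact: eval_at_hom.
  by apply/funext => i; rewrite /= eval_at_coord.
move=> h [hh ah]; apply: PGh_hom_ext => //; first exact: eval_at_hom.
by move=> i; rewrite eval_at_coord ah.
Qed.

(** * The free uniformly complete f-algebra with identity *)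

Section ramp.
Variable R : realType.
Implicit Types r : R.

(** The values are 0 up to 1/2 and 1 from 1 on. *)
Definition ramp r : R := Num.max 0 (Num.min (2 * r - 1) 1).

Lemma ramp_ge0 r : 0 <= ramp r.
Proof. by rewrite le_max lexx. Qed.

Lemma ramp1 : ramp 1 = 1.
Proof. by rewrite /ramp mulr1 (_ : 2 - 1 = 1 :> R) ?minxx ?max_r//; lra. Qed.

Lemma ramp_eq0 r : r <= 1 / 2 -> ramp r = 0.
Proof. by move=> r2; apply/max_l; rewrite ge_min; apply/orP; left; lra. Qed.

(** At [r = 1] the ramp is idempotent and equal to [r]; the explicit factor
    [r - 1] of the two bounds is what a homomorphism sending [r] to the identity
    kills. *)
Lemma ramp_near_idempotent r :
  `|ramp r - ramp r * ramp r| <= `|(r - 1) * (2 * ramp r)|.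
Proof.
rewrite /ramp; case: (leP (2 * r - 1) 1) => r1; last first.
  by rewrite max_r// mulr1 subrr normr0.
case: (leP 0 (2 * r - 1)) => r0; last by rewrite mul0r subrr normr0.
rewrite -[X in `|X| <= _]opprK normrN.
have p : 0 <= (2 * r - 1) * (1 - r) by apply: mulr_ge0; lra.
rewrite [leLHS]ler0_norm ?[leRHS]ler0_norm; nra.
Qed.

Lemma ramp_near_id r : `|ramp r - r| <= `|(r - 1) * (2 * `|r|)|.
Proof.
have h1 := ler_norm (r - 1).
have h2 := ler_norm (- (r - 1)); rewrite normrN in h2.
have nr0 := normr_ge0 r; have nr1 := normr_ge0 (r - 1).
rewrite normrM normrM (ger0_norm nr0) (ger0_norm (ler0n R 2)) /ramp.
case: (leP (2 * r - 1) 1) => r1.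
  case: (leP 0 (2 * r - 1)) => r0.
    by rewrite [`|r|]ger0_norm ?ler_norml; [apply/andP; split; nra|lra].
  by rewrite sub0r normrN; nra.
rewrite max_r// ?ler_norml [`|r|]ger0_norm; [apply/andP; split; nra|lra].
Qed.

End ramp.

Section unital_part.
Variables (R : realType) (n : nat).
Local Notation PG1 := (PG R (1 + n)).
Local Notation PGh1 := (PGh R (1 + n)).

Lemma lipschitz1_continuous (V W : normedModType R) (h : V -> W) :
  (forall x y, `|h x - h y| <= `|x - y|) -> continuous h.
Proof.
move=> hL x; apply/cvgrPdist_lt => e e0; near=> y.
by rewrite (le_lt_trans (hL _ _))//; near: y; apply: cvgr_dist_lt.
Unshelve. all: by end_near. Qed.

Lemma row_norm_le m (x : 'rV[R]_m) (b : R) : 0 <= b ->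
  (forall i, `|x ord0 i| <= b) -> `|x| <= b.
Proof.
move=> b0 xb; rewrite [leLHS]/Num.norm /= mx_normrE.
by apply: bigmax_le => // -[i j] _ /=; rewrite (ord1 i).
Qed.

Lemma rsubmx_continuous : continuous (fun x : 'rV[R]_(1 + n) => rsubmx x).
Proof.
apply: lipschitz1_continuous => x y; apply: row_norm_le => // i.
rewrite !mxE; have := normr_coord_le (x - y) (rshift 1 i).
by rewrite !mxE.
Qed.

(** The part with identity follows from the other one with one more generator, by
    restricting to the hyperplane where the additional coordinate is 1. *)
Definition slice (x : 'rV[R]_n) : 'rV[R]_(1 + n) := row_mx (const_mx 1) x.

Lemma slice_continuous : continuous slice.
Proof.
apply: lipschitz1_continuous => x y; apply: row_norm_le => // i.
rewrite mxE [X in _ + X]mxE /slice; case: (split_ordP i) => j ->.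
  by rewrite !row_mxEl !mxE subrr normr0.
by rewrite !row_mxEr; have := normr_coord_le (x - y) j; rewrite !mxE.
Qed.

Lemma restrict_subproof (h : PG1) : (fun x => h (slice x)) \in @PG_pred R n.
Proof.
have /PG_predP[hc [N [M [N0 M0 hM]]]] := valP h; apply/PG_predP; split.
  move=> x; apply: (@continuous_comp _ _ _ slice (h : _ -> R)).
    exact: slice_continuous.
  exact: hc.
exists N, (M * 2 ^+ N); split=> // [|x]; first by rewrite mulr_ge0// exprn_ge0.
apply: le_trans (hM _) _; rewrite -mulrA -exprMn ler_wpM2l// lerXn2r ?nnegrE//.
- by rewrite (le_trans _ (growth_weight_ge1 _)).
- by rewrite mulr_ge0// (le_trans _ (growth_weight_ge1 _)).
rewrite /growth_weight big_split_ord /= big_ord1 row_mxEl mxE normr1.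
under eq_bigr do rewrite row_mxEr.
rewrite mulrDr mulr1 addrA.
by rewrite (_ : 1 + 1 = 2 :> R)// lerD2l ler_peMl ?sumr_ge0// ler1n.
Qed.

Definition restrict (h : PGh1) : PG R n := MkPG (restrict_subproof h).

Lemma restrict_hom : lattice_algebra_hom restrict.
Proof. by split=> [c f g|f g|f g|f g]; apply: PG_ext. Qed.

Lemma pullback_subproof (f : PG R n) : (fun x => f (rsubmx x)) \in @PG_pred R (1 + n).
Proof.
have /PG_predP[fc [N [M [N0 M0 fM]]]] := valP f; apply/PG_predP; split.
  move=> x; apply: (@continuous_comp _ _ _ (fun x : 'rV[R]_(1 + n) => rsubmx x)
    (f : _ -> R)).
    exact: rsubmx_continuous.
  exact: fc.
exists N, M; split=> // x; apply: le_trans (fM _) _.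
rewrite ler_wpM2l// lerXn2r ?nnegrE//.
- by rewrite (le_trans _ (growth_weight_ge1 _)).
- by rewrite (le_trans _ (growth_weight_ge1 _)).
rewrite /growth_weight lerD2l big_split_ord /= big_ord1.
by under eq_bigr do rewrite mxE; rewrite lerDr.
Qed.

Definition pullback (f : PG R n) : PG1 := MkPG (pullback_subproof f).

Let o : 'I_(1 + n) := lshift n ord0.

Definition cutoff : PG1 :=
  vjoin 0 (vmeet (2 *: PG_coord R o - PG_one R (1 + n)) (PG_one R (1 + n))).

Lemma cutoffE x : cutoff x = ramp (x ord0 o).
Proof. by []. Qed.

Lemma extend_subproof (f : PG R n) : amul cutoff (pullback f) \in @PGh_pred R (1 + n).
Proof.
apply/PGh_predP; exists (cst 0) => B [b [_ bB]] e e0.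
have b1 : 0 < 2 * (`|b| + 1) by rewrite mulr_gt0// ltr_wpDl.
near=> t.
have t0 : 0 < t by [].
have tb : t < (2 * (`|b| + 1))^-1.
  by near: t; apply: nbhs_right_lt; rewrite invr_gt0.
move=> x Bx; have xb : `|x| <= `|b| + 1.
  by apply: bB Bx; rewrite (le_lt_trans (ler_norm b))// ltrDl.
rewrite /radial_quotient [_ (t *: x)](_ : _ = cutoff (t *: x) * pullback f (t *: x))//.
rewrite cutoffE ramp_eq0 ?mul0r ?subrr ?normr0// mxE.
apply: (le_trans (ler_norm _)); rewrite normrM (gtr0_norm t0).
apply: (@le_trans _ _ (t * (`|b| + 1))).
  by rewrite ler_wpM2l ?(ltW t0)// (le_trans (normr_coord_le _ _)).
by move: tb; rewrite -[X in _ < X]mul1r ltr_pdivlMr//; lra.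
Unshelve. all: by end_near. Qed.

(** The cutoff makes the function vanish near the hyperplane where the first
    coordinate is 0, hence near the origin, where the radial limit is thus 0. *)
Definition extend (f : PG R n) : PGh1 := MkPGh (extend_subproof f).

Lemma extendE f x : extend f x = ramp (x ord0 o) * f (rsubmx x).
Proof. by []. Qed.

Lemma restrict_extend f : restrict (extend f) = f.
Proof.
apply: PG_ext => x; rewrite [LHS](_ : _ = extend f (slice x))// extendE.
by rewrite /slice row_mxKr row_mxEl mxE ramp1 mul1r.
Qed.

Lemma PGh_ext (f g : PGh1) : (forall x, f x = g x) -> f = g.
Proof. by move=> fg; apply/val_inj/PG_ext. Qed.

Variables (A : latticeAlgebraType R) (u : A).
Hypotheses (fA : f_algebra A) (uA : uniformly_complete A) (u1 : is_identity u).

Section extend_hom.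
Variable h : PGh1 -> A.
Hypotheses (hh : lattice_algebra_hom h) (ho : h (PGh_coord R o) = u).

(** As [h] maps the first coordinate to the identity, it kills all multiples of
    that coordinate minus 1, hence the ideal that they generate. *)
Lemma hom_slice_eq0 (f k : PGh1) :
  (forall x, `|f x| <= `|(x ord0 o - 1) * k x|) -> h f = 0.
Proof.
move=> fk; apply: vabs_eq0; rewrite -hom_abs//.
have -> : 0 = h (vabs (amul (PGh_coord R o) k - k)).
  by rewrite hom_abs// homB// hom_mul// ho (proj1 (u1 _)) subrr vabs0.
apply: hom_le => //; apply/PGh_leP => x; rewrite !PGh_absE.
apply: le_trans (fk x) _; rewrite mulrBl mul1r.
by [].
Qed.

(** Extension is a lattice homomorphism because the ramp is nonnegative; it is
    multiplicative only up to functions killed by [h]. *)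
Lemma hom_extend : lattice_algebra_hom (h \o extend).
Proof.
split=> [c f g|f g|f g|f g] /=.
- rewrite -hom_lin//; congr h; apply: PGh_ext => x.
  rewrite [RHS](_ : _ = c * extend f x + extend g x)// !extendE.
  by rewrite [(c *: f + g) _](_ : _ = c * f (rsubmx x) + g (rsubmx x))//; ring.
- have [_ hmeet _ _] := hh; rewrite -hmeet; congr h; apply: PGh_ext => x.
  rewrite [RHS](_ : _ = Num.min (extend f x) (extend g x))// !extendE.
  by rewrite -minr_pMr// ramp_ge0.
- rewrite -hom_join//; congr h; apply: PGh_ext => x.
  rewrite [RHS](_ : _ = Num.max (extend f x) (extend g x))// !extendE.
  by rewrite -maxr_pMr// ramp_ge0.
- rewrite -hom_mul//; apply/eqP; rewrite -subr_eq0 -homB//; apply/eqP.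
  apply: (@hom_slice_eq0 _ (2 *: extend (vabs (amul f g)))) => x.
  rewrite [X in `|X| <= _](_ : _ = extend (amul f g) x - extend f x * extend g x)//.
  rewrite [(2 *: _ : PGh1) x](_ : _ = 2 * extend (vabs (amul f g)) x)// !extendE.
  rewrite [amul f g _](_ : _ = f (rsubmx x) * g (rsubmx x))// PG_absE.
  rewrite [amul f g _](_ : _ = f (rsubmx x) * g (rsubmx x))//.
  set r := x ord0 o; set p := f _; set q := g _.
  have -> : ramp r * (p * q) - ramp r * p * (ramp r * q) =
      (ramp r - ramp r * ramp r) * (p * q) by ring.
  have -> : (r - 1) * (2 * (ramp r * `|p * q|)) =
      (r - 1) * (2 * ramp r) * `|p * q| by ring.
  rewrite normrM [leRHS]normrM normr_id.
  by rewrite ler_wpM2r ?normr_ge0// ramp_near_idempotent.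
Qed.

Lemma hom_extend_one : h (extend (PG_one R n)) = u.
Proof.
rewrite -ho; apply/eqP; rewrite -subr_eq0 -homB//; apply/eqP.
apply: (@hom_slice_eq0 _ (2 *: vabs (PGh_coord R o))) => x.
rewrite [X in `|X| <= _](_ : _ = extend (PG_one R n) x - x ord0 o)// extendE mulr1.
rewrite [(2 *: _ : PGh1) x](_ : _ = 2 * vabs (PGh_coord R o : PGh1) x)// PGh_absE.
exact: ramp_near_id.
Qed.

Lemma hom_extend_coord j : h (extend (PG_coord R j)) = h (PGh_coord R (rshift 1 j)).
Proof.
have -> : extend (PG_coord R j) =
    amul (extend (PG_one R n)) (PGh_coord R (rshift 1 j)).
  apply: PGh_ext => x; rewrite extendE.
  rewrite [RHS](_ : _ = extend (PG_one R n) x * x ord0 (rshift 1 j))// extendE mulr1.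
  by rewrite [PG_coord _ _ _](_ : _ = rsubmx x ord0 j)// mxE.
by rewrite hom_mul// hom_extend_one (proj1 (u1 _)).
Qed.

End extend_hom.

(** For uniqueness, a homomorphism on [PG] is composed with the restriction, which
    is onto, and becomes a homomorphism on [PGh]. *)
Lemma PG_hom_exists_unique (a : 'I_n -> A) : exists! h : PG R n -> A,
  [/\ lattice_algebra_hom h, h (PG_one R n) = u & a = h \o (fun i => PG_coord R i)].
Proof.
pose b (i : 'I_(1 + n)) := if fintype.split i is inr j then a j else u.
have bo : b o = u by rewrite /b (unsplitK (inl ord0 : 'I_1 + 'I_n)).
have br j : b (rshift 1 j) = a j by rewrite /b (unsplitK (inr j : 'I_1 + 'I_n)).
have [_ _ /(_ A fA uA b)[h [[hh hb] _]]] := PGh_free R (1 + n).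
have hE i : h (PGh_coord R i) = b i by rewrite hb.
have ho : h (PGh_coord R o) = u by rewrite hE.
exists (h \o extend); split.
  split; [exact: hom_extend|exact: hom_extend_one|].
  by apply/funext => j; rewrite /= hom_extend_coord// hE br.
move=> k [kh k1 ak].
have kr : lattice_algebra_hom (k \o restrict).
  have [rl rm rj rp] := restrict_hom; have [kl km kj kp] := kh.
  split=> [c f g|f g|f g|f g] /=.
  - by rewrite rl kl.
  - by rewrite rm km.
  - by rewrite rj kj.
  - by rewrite rp kp.
have hkr : h = k \o restrict.
  apply: PGh_hom_ext => // i; rewrite hE; case: (split_ordP i) => j ->.
    rewrite (ord1 j) bo /= -k1; congr k; apply: PG_ext => x.
    rewrite [RHS](_ : _ = slice x ord0 o)// /slice row_mxEl mxE.
    by [].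
  rewrite br ak /=; congr k; apply: PG_ext => x.
  by rewrite [RHS](_ : _ = slice x ord0 (rshift 1 j))// /slice row_mxEr.
by apply/funext => f; rewrite hkr /= restrict_extend.
Qed.

End unital_part.

Theorem PG_free (R : realType) n :
  free_uc_falgebra_with_id (PG_one R n) (fun i : 'I_n => PG_coord R i).
Proof.
split; [exact: PG_f_algebra|exact: PG_uniformly_complete| |].
  by move=> f; split; apply: PG_ext => x; [exact: mul1r|exact: mulr1].
move=> A u fA uA u1 a; exact: PG_hom_exists_unique.
Qed.

Theorem theorem2p8 (R : realType) (n : nat) (n_gt0 : (0 < n)%N) :
  free_uc_falgebra (fun i : 'I_n => PGh_coord R i) /\
  free_uc_falgebra_with_id (PG_one R n) (fun i : 'I_n => PG_coord R i).
Proof. by split; [exact: PGh_free|exact: PG_free]. Qed.
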